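(* Let $M$ be a connected Riemann surface and let $\omega$ be a Weierstrass representation of $M$ with $\operatorname{Re}(\omega)$ closed. Then there exists a conformal immersion $M_{\operatorname{Re}(\omega)}\to\mathbb{R}^3$ whose corresponding Weierstrass representation is $\pi_{\operatorname{Re}(\omega)}^*\omega$. All such immersions differ by a translation in $\mathbb{R}^3$. Finally, $\omega$ comes from a conformal immersion of $M$ itself (i.e. $M_{\operatorname{Re}(\omega)}=M$) if and only if all the periods of $\omega$ are purely imaginary.
   Context: Let $I$ be the complex structure on $TM$. A Weierstrass representation of a Riemann surface $M$ is a $\mathbb{C}^3$-valued smooth $(1,0)$-form $\omega=(\omega_1,\omega_2,\omega_3)$ on $M$ which is nowhere vanishing (the $\omega_i$ have no common zero) and satisfies $\omega_1^2+\omega_2^2+\omega_3^2=0$. The Weierstrass representation corresponding to (coming from) a conformal immersion $\varphi\colon M\to\mathbb{R}^3$ is $\omega=2\partial\varphi$, i.e. $\omega(v)=d\varphi(v)-i\,d\varphi(Iv)$. For a closed $1$-form $\alpha$ on $M$ with values in a finite-dimensional vector space $V$ and $p_0\in M$, let $\int_{p_0}\alpha\colon\pi_1(M,p_0)\to V$ be the homomorphism $[\gamma]\mapsto\int_\gamma\alpha$ ($\gamma$ piecewise smooth), and let $\Gamma$ be its kernel. $\pi_\alpha\colon M_\alpha\to M$ denotes the connected covering corresponding to the normal subgroup $\Gamma$, i.e. $(\pi_\alpha)_*\pi_1(M_\alpha)=\Gamma$; it is given the complex structure pulled back from $M$. The statement uses $\alpha=\operatorname{Re}(\omega)$, $V=\mathbb{R}^3$.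 The periods of $\omega$ are the integrals $\int_\gamma\omega\in\mathbb{C}^3$ over piecewise smooth loops $\gamma$ in $M$; they are purely imaginary if they lie in $i\mathbb{R}^3$. *)

(* Defs.v *)
From mathcomp Require Import all_boot all_order all_algebra.
From mathcomp Require Import complex.
From mathcomp Require Import all_classical all_reals all_analysis.
Set Implicit Arguments.
Unset Strict Implicit.
Unset Printing Implicit Defensive.
Import Order.TTheory GRing.Theory Num.Theory.
Import numFieldNormedType.Exports.
Local Open Scope classical_set_scope.
Local Open Scope ring_scope.

Fixpoint Ck_on (R : realType) (V W : normedModType R) (k : nat) (U : set V)
    (f : V -> W) : Prop :=
  match k with
  | 0 => forall x, U x -> {for x, continuous f}
  | k'.+1 => (forall x, U x -> differentiable f x) /\
             (forall v, Ck_on k' U ('D_v f))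
  end.

(* Meant for open U. *)
Definition smooth_on (R : realType) (V W : normedModType R) (U : set V)
    (f : V -> W) : Prop :=
  forall k, Ck_on k U f.

(* The complex line as a real normed space: (x, y) stands for x + iy, so that
   [cJ] is the multiplication by i. *)
Notation plane R := (R * R)%type (only parsing).

Definition cJ (R : realType) (v : plane R) : plane R := (- v.2, v.1).

(* Complex differentiability: the real differential exists and is C-linear. *)
Definition holomorphic_on (R : realType) (U : set (plane R))
    (f : plane R -> plane R) : Prop :=
  forall z, U z -> differentiable f z /\
    forall v, 'd f z (cJ v) = cJ ('d f z v).

(* [cmap] only matters on [cdom], and [cinv] only on [cmap @` cdom]. *)
Record chart (R : realType) (M : topologicalType) := Chart {
  cdom : set M;
  cmap : M -> plane R;
  cinv : plane R -> M }.

Definition cimg (R : realType) (M : topologicalType) (c : chart R M) :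
    set (plane R) :=
  cmap c @` cdom c.

Definition is_chart (R : realType) (M : topologicalType) (c : chart R M) :
    Prop :=
  [/\ open (cdom c),
      open (cimg c),
      (forall q, cdom c q -> cinv c (cmap c q) = q),
      {within cdom c, continuous (cmap c)} &
      {within cimg c, continuous (cinv c)}].

Definition complex_atlas (R : realType) (M : topologicalType)
    (A : set (chart R M)) : Prop :=
  [/\ (forall c, A c -> is_chart c),
      (forall q, exists2 c, A c & cdom c q) &
      (forall c d, A c -> A d ->
         holomorphic_on (cmap c @` (cdom c `&` cdom d)) (cmap d \o cinv c))].

(* Second countability is not imposed: for connected surfaces it follows
   (Rado). *)
Definition riemann_surface (R : realType) (M : topologicalType)
    (A : set (chart R M)) : Prop :=
  hausdorff_space M /\ complex_atlas A.

(* A 1-form with values in V: [alpha c q v] is its value at q on the tangent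
   vector whose coordinates in the chart c are v.  As the charts are
   holomorphic, the complex structure I of the tangent bundle is [cJ] in the
   coordinates of every chart. *)
Definition one_form (R : realType) (M : topologicalType) (V : Type) : Type :=
  chart R M -> M -> plane R -> V.

(* R-linearity at every point, and compatibility with changes of charts. *)
Definition is_form (R : realType) (M : topologicalType) (A : set (chart R M))
    (n : nat) (omega : one_form R M 'rV[R[i]]_n) : Prop :=
  (forall c q, A c -> cdom c q -> forall (a : R) (u v : plane R),
     omega c q (a *: u + v) = a%:C%C *: omega c q u + omega c q v) /\
  (forall c d q, A c -> A d -> cdom c q -> cdom d q -> forall v : plane R,
     omega c q v = omega d q ('d (cmap d \o cinv c) (cmap c q) v)).

Definition re_form (R : realType) (M : topologicalType) (n : nat)
    (omega : one_form R M 'rV[R[i]]_n) : one_form R M 'rV[R]_n :=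
  fun c q v => map_mx (@complex.Re R) (omega c q v).

Definition im_form (R : realType) (M : topologicalType) (n : nat)
    (omega : one_form R M 'rV[R[i]]_n) : one_form R M 'rV[R]_n :=
  fun c q v => map_mx (@complex.Im R) (omega c q v).

Definition smooth_form (R : realType) (M : topologicalType)
    (A : set (chart R M)) (n : nat) (alpha : one_form R M 'rV[R]_n) : Prop :=
  forall c, A c -> forall v : plane R,
    smooth_on (cimg c) (fun z => alpha c (cinv c z) v).

(* In a chart alpha = P dx + Q dy, and d alpha = (dQ/dx - dP/dy) dx /\ dy. *)
Definition closed_form (R : realType) (M : topologicalType)
    (A : set (chart R M)) (n : nat) (alpha : one_form R M 'rV[R]_n) : Prop :=
  forall c, A c -> forall z, cimg c z ->
    let ex : plane R := (1, 0) in
    let ey : plane R := (0, 1) in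
    'D_ex (fun w => alpha c (cinv c w) ey) z =
    'D_ey (fun w => alpha c (cinv c w) ex) z.

Definition weierstrass_representation (R : realType) (M : topologicalType)
    (A : set (chart R M)) (omega : one_form R M 'rV[R[i]]_3) : Prop :=
  [/\ is_form A omega,
      smooth_form A (re_form omega) /\ smooth_form A (im_form omega),
      (forall c q, A c -> cdom c q -> forall v : plane R,
         omega c q (cJ v) = 'i%C *: omega c q v),
      (forall c q, A c -> cdom c q -> exists v : plane R, omega c q v != 0) &
      (forall c q, A c -> cdom c q -> forall v : plane R,
         \sum_(j < 3) omega c q v 0 j ^+ 2 = 0)].

Definition form_eq (R : realType) (M : topologicalType) (V : Type)
    (A : set (chart R M)) (alpha beta : one_form R M V) : Prop :=
  forall c q, A c -> cdom c q -> forall v, alpha c q v = beta c q v.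

(* beta = p^* alpha: beta(v) = alpha(dp(v)), with dp read in charts. *)
Definition is_pullback (R : realType) (M N : topologicalType) (V : Type)
    (A : set (chart R M)) (B : set (chart R N)) (p : N -> M)
    (alpha : one_form R M V) (beta : one_form R N V) : Prop :=
  forall c d q, A c -> B d -> cdom d q -> cdom c (p q) ->
  forall v, beta d q v =
            alpha c (p q) ('d (cmap c \o p \o cinv d) (cmap d q) v).

Definition dmap (R : realType) (M : topologicalType) (n : nat)
    (phi : M -> 'rV[R]_n) : one_form R M 'rV[R]_n :=
  fun c q v => 'd (phi \o cinv c) (cmap c q) v.

Definition dotr (R : realType) (n : nat) (u v : 'rV[R]_n) : R :=
  \sum_(j < n) u 0 j * v 0 j.

Definition conformal_immersion (R : realType) (M : topologicalType)
    (A : set (chart R M)) (phi : M -> 'rV[R]_3) : Prop :=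
  [/\ (forall c, A c -> smooth_on (cimg c) (phi \o cinv c)),
      (forall c q, A c -> cdom c q -> injective (dmap phi c q)) &
      (forall c q, A c -> cdom c q -> exists2 lambda : R, 0 < lambda &
         forall v w : plane R, dotr (dmap phi c q v) (dmap phi c q w) =
                               lambda * (v.1 * w.1 + v.2 * w.2))].

(* v |-> d phi (v) - i d phi (I v) *)
Definition weierstrass_of (R : realType) (M : topologicalType)
    (phi : M -> 'rV[R]_3) : one_form R M 'rV[R[i]]_3 :=
  fun c q v => map_mx (real_complex R) (dmap phi c q v) -
               'i%C *: map_mx (real_complex R) (dmap phi c q (cJ v)).

Record smooth_arc (R : realType) (M : topologicalType) := SmoothArc {
  asrc : R;
  atgt : R;
  achart : chart R M;
  acoord : R -> plane R }.

(* The restriction of gamma to [asrc, atgt] stays in the chart and is smooth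
   up to the endpoints: in coordinates it extends to a smooth map on R. *)
Definition arc_of (R : realType) (M : topologicalType) (A : set (chart R M))
    (gamma : R -> M) (a : smooth_arc R M) : Prop :=
  [/\ asrc a < atgt a, A (achart a),
      smooth_on (setT : set R) (acoord a) &
      forall t : R, t \in `[asrc a, atgt a] ->
        cdom (achart a) (gamma t) /\ cmap (achart a) (gamma t) = acoord a t].

Fixpoint subdivision (R : realType) (M : topologicalType)
    (A : set (chart R M)) (gamma : R -> M) (t0 : R) (s : seq (smooth_arc R M))
    (t1 : R) : Prop :=
  match s with
  | [::] => t0 = t1
  | a :: s' => [/\ asrc a = t0, arc_of A gamma a &
                   subdivision A gamma (atgt a) s' t1]
  end.

Definition arc_integral (R : realType) (M : topologicalType) (n : nat)
    (alpha : one_form R M 'rV[R]_n) (gamma : R -> M) (a : smooth_arc R M) :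
    'rV[R]_n :=
  \row_j \int[lebesgue_measure]_(t in `[asrc a, atgt a])
     alpha (achart a) (gamma t) (derive1 (acoord a) t) 0 j.

Definition sub_integral (R : realType) (M : topologicalType) (n : nat)
    (alpha : one_form R M 'rV[R]_n) (gamma : R -> M)
    (s : seq (smooth_arc R M)) :
    'rV[R]_n :=
  \sum_(a <- s) arc_integral alpha gamma a.

(* gamma : [0, 1] -> M is piecewise smooth, and I is the integral of alpha
   along gamma.  I does not depend on the subdivision. *)
Definition line_integral (R : realType) (M : topologicalType)
    (A : set (chart R M)) (n : nat) (alpha : one_form R M 'rV[R]_n)
    (gamma : R -> M) (I : 'rV[R]_n) : Prop :=
  exists2 s, subdivision A gamma 0 s 1 & I = sub_integral alpha gamma s.

Definition complex_line_integral (R : realType) (M : topologicalType)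
    (A : set (chart R M)) (n : nat) (omega : one_form R M 'rV[R[i]]_n)
    (gamma : R -> M) (I : 'rV[R[i]]_n) : Prop :=
  exists2 s, subdivision A gamma 0 s 1 &
    I = map_mx (real_complex R) (sub_integral (re_form omega) gamma s) +
        'i%C *: map_mx (real_complex R) (sub_integral (im_form omega) gamma s).

Definition is_period (R : realType) (M : topologicalType)
    (A : set (chart R M)) (n : nat) (omega : one_form R M 'rV[R[i]]_n)
    (I : 'rV[R[i]]_n) : Prop :=
  exists2 gamma : R -> M, gamma 0 = gamma 1 &
    complex_line_integral A omega gamma I.

Definition purely_imaginary (R : realType) (n : nat) (z : 'rV[R[i]]_n) :
    Prop :=
  exists y : 'rV[R]_n, z = 'i%C *: map_mx (real_complex R) y.

(* Paths are functions on R of which only the restriction to [0, 1] matters. *)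
Definition is_loop (R : realType) (M : topologicalType) (x : M)
    (gamma : R -> M) : Prop :=
  [/\ {within `[0, 1], continuous gamma}, gamma 0 = x & gamma 1 = x].

(* Homotopy of loops at x, relative to the endpoints. *)
Definition homotopic (R : realType) (M : topologicalType) (x : M)
    (gamma delta : R -> M) : Prop :=
  exists H : R * R -> M,
    {within `[0, 1] `*` `[0, 1], continuous H} /\
    forall t : R, t \in `[0, 1] ->
      [/\ H (0, t) = gamma t, H (1, t) = delta t, H (t, 0) = x &
          H (t, 1) = x].

(* A subset of pi_1(M, x) is represented by the set of all loops whose homotopy
   class belongs to it. *)

(* The kernel of [gamma] |-> \int_gamma alpha, gamma piecewise smooth. *)
Definition period_kernel (R : realType) (M : topologicalType)
    (A : set (chart R M)) (n : nat) (alpha : one_form R M 'rV[R]_n) (x : M) :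
    set (R -> M) :=
  [set gamma | is_loop x gamma /\ exists delta : R -> M,
     [/\ is_loop x delta, homotopic x gamma delta &
         line_integral A alpha delta 0]].

(* p_* pi_1(N, y) inside pi_1(M, p y). *)
Definition pi1_image (R : realType) (M N : topologicalType) (p : N -> M)
    (y : N) : set (R -> M) :=
  [set gamma | is_loop (p y) gamma /\ exists delta : R -> N,
     is_loop y delta /\ homotopic (p y) gamma (p \o delta)].

(* p maps V homeomorphically onto U, with inverse s. *)
Definition is_sheet (M N : topologicalType) (p : N -> M) (U : set M)
    (V : set N) : Prop :=
  exists s : M -> N,
    [/\ (forall x, U x -> V (s x) /\ p (s x) = x),
        (forall y, V y -> U (p y) /\ s (p y) = y) &
        {within U, continuous s}].

Definition covering (M N : topologicalType) (p : N -> M) : Prop :=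
  continuous p /\
  forall x, exists U : set M, [/\ open U, U x &
    exists F : set (set N),
      [/\ trivIset F id, \bigcup_(V in F) V = p @^-1` U &
          forall V, F V -> open V /\ is_sheet p U V]].

Definition covering_of_form (R : realType) (M N : topologicalType)
    (A : set (chart R M)) (n : nat) (alpha : one_form R M 'rV[R]_n)
    (x0 : M) (p : N -> M) (y0 : N) : Prop :=
  [/\ covering p, connected [set: N], p y0 = x0 &
      pi1_image p y0 = period_kernel A alpha x0].

(* The pulled back complex structure: the charts are the lifts by p of the
   charts of A. *)
Definition pullback_atlas (R : realType) (M N : topologicalType)
    (p : N -> M) (A : set (chart R M)) : set (chart R N) :=
  [set d | is_chart d /\ exists2 c, A c &
     forall y, cdom d y -> cdom c (p y) /\ cmap d y = cmap c (p y)].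

Definition is_homeomorphism (M N : topologicalType) (p : N -> M) : Prop :=
  continuous p /\ exists s : M -> N, [/\ continuous s, cancel p s & cancel s p].

(* Main.v *)
(* Locally, the closed form Re omega has primitives, unique up to a constant
   (Poincare lemma): the primitives form a locally constant sheaf, and so do the
   sections of a covering. Paths and homotopies lift through such a sheaf, which
   gives the homotopy invariance of the integral of Re omega and the unique
   lifting in coverings from one and the same statement (monodromy).

   A loop in N projects to a loop homotopic to a piecewise smooth one on which
   Re omega has integral 0, hence the integral of p^* Re omega along paths from
   y0 defines phi on N with d phi = p^* Re omega. As omega (I v) = i omega v, the
   form determined by phi is p^* omega, and omega_1^2 + omega_2^2 + omega_3^2 = 0
   says exactly that d phi is conformal.

   If the periods are imaginary, then every loop at p0, being homotopic to a
   piecewise smooth one, lifts to a loop, so that p is injective and phi descends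
   to M. Conversely, a primitive of Re omega on M has no periods. *)

From HB Require Import structures.
Require Import Defs.
From mathcomp Require Import all_boot all_order all_algebra.
From mathcomp Require Import complex.
From mathcomp Require Import all_classical all_reals all_analysis.
From mathcomp Require Import lra ring.
Set Implicit Arguments.
Unset Strict Implicit.
Unset Printing Implicit Defensive.
Import Order.TTheory GRing.Theory Num.Theory.
Import numFieldNormedType.Exports.
Local Open Scope classical_set_scope.
Local Open Scope ring_scope.

(** * Locally constant sheaves and lifting *)

(** Along a merely continuous path no integral of Re omega is available, and the homotopies that
    define the covering are only continuous. The integral is therefore replaced by the increment of
    a lift through the sheaf of primitives, which makes sense for every continuous path; it meets
    the actual integral only on piecewise smooth paths, through the fundamental theorem of calculus.
    The etale space of the sheaf is never built: a lift records values only, and the axiom that two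
    sections with a common value have a common germ restores the rest. The set [fib] of admissible
    values is everything for primitives and the fibre of [p] for sections. The equality of subgroups
    that defines the covering is used once in each direction: the image of pi_1(N) lies in the
    period kernel, which makes the primitive on [N] single-valued, and the reverse inclusion makes
    [p] injective when the periods are imaginary. *)

Lemma near_withinP (T : topologicalType) (C P : set T) (x : T) :
  (\forall y \near within C (nbhs x), P y) <-> (\forall y \near x, C y -> P y).
Proof. by rewrite near_withinE. Qed.

Lemma pair_cvg (T : Type) (F : set_system T) (FF : Filter F)
    (U V : topologicalType) (f : T -> U) (g : T -> V) (a : U) (b : V) :
  f @ F --> a -> g @ F --> b -> (f x, g x) @[x --> F] --> (a, b).
Proof. by move=> fa gb; apply: cvg_pair. Qed.

Lemma continuous_within_comp (T U V : topologicalType) (C : set T) (D : set U)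
    (f : T -> U) (g : U -> V) :
  {within D, continuous g} -> {within C, continuous f} ->
  (forall x, C x -> D (f x)) -> {within C, continuous (g \o f)}.
Proof.
move=> /subspace_continuousP gc /subspace_continuousP fc fCD.
apply/subspace_continuousP => x Cx.
apply: (cvg_comp _ _ _ (gc _ (fCD _ Cx))).
move=> P /near_withinP H; rewrite nbhs_simpl /=; apply/near_withinP.
have := fc _ Cx _ H; rewrite nbhs_simpl /= => /near_withinP.
by apply: filterS => y HP Cy; apply: HP => //; exact: fCD.
Qed.

(** The equivalence required near each point makes both [E] and its complement open relative to
    [C]. *)
Lemma connected_induction (T : topologicalType) (C E : set T) (x0 : T) :
  connected C -> C x0 -> E x0 ->
  (forall x, C x -> \forall y \near within C (nbhs x), E y <-> E x) ->
  C `<=` E.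
Proof.
move=> Cc Cx0 Ex0 loc.
suff CE : C `&` E = C by move=> x; rewrite -CE => -[].
apply: Cc.
- by exists x0.
- exists (~` C `|` E)°; first exact: open_interior.
  apply/seteqP; split => x [Cx]; last first.
    by move/nbhs_singleton => -[].
  move=> Ex; split=> //; have /near_withinP := loc _ Cx.
  by apply: filterS => y H; have [/H[_ ?]|] := pselect (C y); [right; auto|left].
- exists (~` (~` C `|` ~` E)°); first exact/open_closedC/open_interior.
  apply/seteqP; split => x [Cx].
    by move=> Ex; split=> // /nbhs_singleton -[].
  move=> nE; split=> //; apply: contrapT => Ex; apply: nE.
  have /near_withinP := loc _ Cx.
  by apply: filterS => y H; have [/H[? _]|] := pselect (C y); [right => ?; auto|left].
Qed.

Section LocalSystem.
Variables (M : topologicalType) (F : Type).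

(** A local product structure: a section of [L] passes through each admissible value, and a member
    of [L] is determined on all of [U] by one value. The set [U] need not be connected. *)
Definition sections_through (fib : M -> set F) (L : set (M -> F)) (U : set M) :=
  (forall x v, U x -> fib x v -> exists2 s, L s & s x = v) /\
  (forall s t x, L s -> L t -> U x -> s x = t x -> {in U, s =1 t}).

(* [S U s] means that s restricted to U is a section over U of a sheaf on M
   with fibres [fib]; the values of s outside U do not matter. *)
Definition local_system (fib : M -> set F) (S : set M -> (M -> F) -> Prop) :=
  [/\ (forall U s x, S U s -> U x -> fib x (s x)),
      (forall U s V t x, S U s -> S V t -> U x -> V x -> s x = t x ->
         \forall y \near x, s y = t y) &
      (forall x : M, exists U L, [/\ nbhs x U, (forall s, L s -> S U s) &
         sections_through fib L U])].

(** A continuous lift of [h] to the etale space of the sheaf, recorded by the values of the germs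
    alone. *)
Definition lifts (S : set M -> (M -> F) -> Prop) (T : topologicalType)
    (h : T -> M) (C : set T) (g : T -> F) :=
  forall x, C x -> exists U s, [/\ S U s, U (h x) &
    \forall y \near within C (nbhs x), g y = s (h y)].

Variables (fib : M -> set F) (S : set M -> (M -> F) -> Prop).
Hypothesis HS : local_system fib S.

Section Lifts.
Variable T : topologicalType.
Implicit Types (h : T -> M) (g : T -> F) (C : set T).

Lemma near_within_self C x (P : T -> Prop) :
  C x -> (\forall y \near within C (nbhs x), P y) -> P x.
Proof. by move=> Cx /nbhs_singleton; exact. Qed.

Lemma lifts_fib h C g x : lifts S h C g -> C x -> fib (h x) (g x).
Proof.
move=> /(_ x) + Cx => /(_ Cx) [U [s [SU Ux gs]]].
by rewrite (near_within_self Cx gs); case: HS => + _ _; apply; first exact: SU.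
Qed.

(** The section provided by the definition of a lift can be traded for any other with the same value
    at the point, since both have the same germ there. *)
Lemma lifts_near h C g x U s : {within C, continuous h} -> lifts S h C g ->
  C x -> S U s -> U (h x) -> s (h x) = g x ->
  \forall y \near within C (nbhs x), g y = s (h y).
Proof.
move=> /subspace_continuousP hc gl Cx SUs Ux sg.
have [V [t [SVt Vx gt]]] := gl _ Cx.
have [_ germ _] := HS.
have st : t (h x) = s (h x) by rewrite sg (near_within_self Cx gt).
have := hc _ Cx _ (germ _ _ _ _ _ SVt SUs Vx Ux st).
rewrite nbhs_simpl /= => ts; near=> y.
have Cy : C y by near: y; apply/near_withinP/nearW.
by rewrite (near gt y) ?(near ts y).
Unshelve. all: by end_near. Qed.

Lemma lifts_subset h C D g : D `<=` C -> lifts S h C g -> lifts S h D g.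
Proof.
move=> DC gl x /DC /gl [U [s [? ? gs]]]; exists U, s; split=> //.
apply/near_withinP; move/near_withinP: gs.
by apply: filterS => y gs /DC; exact: gs.
Qed.

Lemma eq_lifts h1 h2 C g1 g2 : {in C, h1 =1 h2} -> {in C, g1 =1 g2} ->
  lifts S h1 C g1 -> lifts S h2 C g2.
Proof.
move=> hE gE gl x Cx; have [U [s [? ? gs]]] := gl _ Cx; exists U, s; split=> //.
  by rewrite -hE ?inE.
apply/near_withinP; move/near_withinP: gs; apply: filterS => y gs Cy.
by rewrite -gE ?inE// -hE ?inE//; exact: gs.
Qed.

(** Near a point the two lifts follow two sections of one family [L]. These agree at one point of
    [U] exactly when they agree on [U], so the coincidence set is locally constant. *)
Lemma lifts_unique h C g1 g2 x0 : connected C -> {within C, continuous h} ->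
  lifts S h C g1 -> lifts S h C g2 -> C x0 -> g1 x0 = g2 x0 ->
  {in C, g1 =1 g2}.
Proof.
move=> Cc hc l1 l2 Cx0 e0 x; rewrite inE.
apply: (connected_induction (E := fun x => g1 x = g2 x)) Cc Cx0 e0 _ x => x Cx.
have [fibS germ /(_ (h x))[U [L [Ux LS [Lthrough Luniq]]]]] := HS.
have hx := nbhs_singleton Ux.
have [t1 Lt1 t1g] := Lthrough _ _ hx (lifts_fib l1 Cx).
have [t2 Lt2 t2g] := Lthrough _ _ hx (lifts_fib l2 Cx).
have n1 := lifts_near hc l1 Cx (LS _ Lt1) hx t1g.
have n2 := lifts_near hc l2 Cx (LS _ Lt2) hx t2g.
have /subspace_continuousP/(_ _ Cx _ Ux) := hc; rewrite nbhs_simpl /= => nU.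
near=> y.
have Cy : C y by near: y; apply/near_withinP/nearW.
rewrite (near n1 y)// (near n2 y)// -t1g -t2g.
have hy : U (h y) by near: y.
split=> e; first by rewrite (Luniq _ _ _ Lt1 Lt2 hy e) ?inE.
by rewrite (Luniq _ _ _ Lt1 Lt2 hx e) ?inE.
Unshelve. all: by end_near. Qed.

Lemma lifts_glue h C1 C2 g1 g2 : closed C1 -> closed C2 ->
  {within C1 `|` C2, continuous h} -> lifts S h C1 g1 -> lifts S h C2 g2 ->
  {in C1 `&` C2, g1 =1 g2} ->
  exists g, [/\ lifts S h (C1 `|` C2) g, {in C1, g =1 g1} & {in C2, g =1 g2}].
Proof.
move=> cl1 cl2 hc l1 l2 e12.
have hc1 : {within C1, continuous h}.
  by apply: continuous_subspaceW hc; exact: subsetUl.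
have hc2 : {within C2, continuous h}.
  by apply: continuous_subspaceW hc; exact: subsetUr.
pose g x := if x \in C1 then g1 x else g2 x.
have gE1 : {in C1, g =1 g1} by move=> x xC; rewrite /g xC.
have gE2 : {in C2, g =1 g2}.
  move=> x xC; rewrite /g; case: ifPn => // xC1.
  by apply: e12; rewrite in_setI xC xC1.
exists g; split=> // x Cx.
have [C1x|nC1x] := pselect (C1 x).
  have [U [s [SU Ux gs]]] := l1 _ C1x; exists U, s; split=> //.
  (* At a common point the section following [g1] also follows [g2], because the values agree there;
     off the closed set [C2] the condition is vacuous nearby. *)
  have gs' : \forall y \near within C2 (nbhs x), g2 y = s (h y).
    have [C2x|nC2x] := pselect (C2 x).
      apply: (lifts_near hc2 l2 C2x SU Ux).
      by rewrite -(near_within_self C1x gs) e12// inE.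
    have : \forall y \near x, (~` C2) y.
      by apply: open_nbhs_nbhs; split=> //; exact/closed_openC.
    by move=> H; apply/near_withinP; apply: filterS H.
  apply/near_withinP; move/near_withinP: gs => gs; move/near_withinP: gs'.
  move: gs; apply: filterS2 => y H1 H2 [Cy|Cy].
    by rewrite gE1 ?inE//; exact: H1.
  by rewrite gE2 ?inE//; exact: H2.
have C2x : C2 x by case: Cx.
have [U [s [SU Ux gs]]] := l2 _ C2x; exists U, s; split=> //.
have : \forall y \near x, (~` C1) y.
  by apply: open_nbhs_nbhs; split=> //; exact/closed_openC.
move=> H; apply/near_withinP; move/near_withinP: gs => gs; move: H gs.
apply: filterS2 => y H1 H2 [//|Cy].
by rewrite gE2 ?inE//; exact: H2.
Qed.

End Lifts.

Lemma lifts_comp (T T' : topologicalType) (h : T -> M) C g (i : T' -> T) D :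
  {within D, continuous i} -> (forall x, D x -> C (i x)) -> lifts S h C g ->
  lifts S (h \o i) D (g \o i).
Proof.
move=> /subspace_continuousP ic DC gl x Dx; have [U [s [? ? gs]]] := gl _ (DC _ Dx).
exists U, s; split=> //=.
have := ic _ Dx; move/near_withinP: gs => gs /(_ _ gs).
rewrite nbhs_simpl /= => /near_withinP H; apply/near_withinP.
by apply: filterS H => y H Dy; apply: H => //; exact: DC.
Qed.

End LocalSystem.

(** * Real induction and lifting over a square *)

Section Square.
Variable R : realType.

(** Real induction, by the supremum of the points that can be reached from 0. It replaces a Lebesgue
    number argument both for lifting over a square and for smoothing a path. *)
Lemma interval_induction (Q : R -> R -> Prop) :
  (forall a b c : R, 0 <= a -> a <= b -> b <= c -> c <= 1 ->
     Q a b -> Q b c -> Q a c) ->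
  (forall x : R, 0 <= x <= 1 -> exists2 e : R, 0 < e & forall a b : R, 0 <= a -> a <= b ->
     b <= 1 -> `|a - x| < e -> `|b - x| < e -> Q a b) ->
  Q 0 1.
Proof.
move=> trans loc.
pose E := [set x : R | 0 <= x <= 1 /\ Q 0 x].
have E0 : E 0.
  split; first by rewrite lexx ler01.
  have [|e e0] := loc 0; first by rewrite lexx ler01.
  by apply=> //; rewrite ?ler01// subrr normr0.
have ubE : has_ubound E by exists 1 => x [/andP[]].
have sE : has_sup E by split=> //; exists 0.
pose m := sup E.
have m0 : 0 <= m by exact: (ub_le_sup ubE).
have m1 : m <= 1 by apply: ge_sup; [exists 0|move=> x [/andP[]]].
have [|e e0 Hm] := loc m; first by rewrite m0 m1.
have [x [/andP[x0 x1] Qx] xm] := sup_adherent e0 sE.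
rewrite -/m in xm.
have xlem : x <= m by apply: (ub_le_sup ubE); split=> //; rewrite x0.
(* Half a radius beyond the supremum, truncated at 1, is still reached; as the supremum cannot be
   exceeded, the truncation must have taken place. *)
pose b := Num.min 1 (m + e / 2).
have mb : m <= b by rewrite le_min m1/=; lra.
have b1 : b <= 1 by rewrite ge_min lexx.
have bme : b <= m + e / 2 by rewrite ge_min lexx orbT.
have Qb : Q 0 b.
  apply: (trans _ x); rewrite ?lexx//; first lra.
  by apply: Hm; rewrite ?ler_norml ?ltr_norml; lra.
have bm : b <= m by apply: (ub_le_sup ubE); split=> //; lra.
suff <- : b = 1 by [].
by move: bm; rewrite /b; case: (leP 1 (m + e/2)) => // *; lra.
Qed.

Definition rect (a b c d : R) : set (R * R) := `[a, b] `*` `[c, d].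

Lemma rectP a b c d x : rect a b c d x <->
  a <= x.1 <= b /\ c <= x.2 <= d.
Proof. by rewrite /rect/= !in_itv. Qed.

Lemma closed_rect a b c d : closed (rect a b c d).
Proof.
have -> : rect a b c d = (fst @^-1` `[a, b]) `&` (snd @^-1` `[c, d]) by [].
apply: closedI; apply: closed_comp; try exact: itv_closed.
  by move=> x _; exact: cvg_fst.
by move=> x _; exact: cvg_snd.
Qed.

Lemma rectU_h a b c d e : a <= b -> b <= e ->
  rect a b c d `|` rect b e c d = rect a e c d.
Proof.
move=> ab be; apply/seteqP; split=> x.
  by case=> /rectP[? ?]; apply/rectP; split=> //; lra.
move=> /rectP[H1 H2]; have [|] := leP x.1 b => H; [left|right];
  by apply/rectP; split=> //; lra.
Qed.

Lemma rectU_v a b c d e : c <= d -> d <= e ->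
  rect a b c d `|` rect a b d e = rect a b c e.
Proof.
move=> ab be; apply/seteqP; split=> x.
  by case=> /rectP[? ?]; apply/rectP; split=> //; lra.
move=> /rectP[H1 H2]; have [|] := leP x.2 d => H; [left|right];
  by apply/rectP; split=> //; lra.
Qed.

Lemma rectI_h a b c d e : a <= b -> b <= e ->
  rect a b c d `&` rect b e c d = (fun t => (b, t)) @` `[c, d].
Proof.
move=> ab be; apply/seteqP; split=> [x [/rectP[? ?] /rectP[? ?]]|_ [t + <-]].
  exists x.2; first by rewrite /= in_itv.
  by rewrite [RHS]surjective_pairing; congr pair; lra.
by rewrite /= in_itv/= => tcd; split; apply/rectP => /=; split=> //; lra.
Qed.

Lemma rectI_v a b c d e : c <= d -> d <= e ->
  rect a b c d `&` rect a b d e = (fun t => (t, d)) @` `[a, b].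
Proof.
move=> ab be; apply/seteqP; split=> [x [/rectP[? ?] /rectP[? ?]]|_ [t + <-]].
  exists x.1; first by rewrite /= in_itv.
  by rewrite [RHS]surjective_pairing; congr pair; lra.
by rewrite /= in_itv/= => tcd; split; apply/rectP => /=; split=> //; lra.
Qed.

Variables (M : topologicalType) (F : Type) (fib : M -> set F).
Variable S : set M -> (M -> F) -> Prop.
Hypothesis HS : local_system fib S.

Variable h : R * R -> M.
Hypothesis hc : {within rect 0 1 0 1, continuous h}.

Let liftable (C : set (R * R)) := forall x v, C x -> fib (h x) v ->
  exists2 g, lifts S h C g & g x = v.

(** The lift over one piece fixes a value at a point of the overlap, through which the other piece
    is lifted; connectedness of the overlap makes the two lifts agree there. The prescribed point
    may lie in either piece, hence the helper [key] with generic pieces. *)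
Lemma liftableU C1 C2 : C1 `|` C2 `<=` rect 0 1 0 1 -> closed C1 -> closed C2 ->
  C1 `&` C2 !=set0 -> connected (C1 `&` C2) ->
  liftable C1 -> liftable C2 -> liftable (C1 `|` C2).
Proof.
move=> sub.
have key A B x v : A `|` B `<=` rect 0 1 0 1 -> closed A -> closed B ->
    A `&` B !=set0 -> connected (A `&` B) ->
    liftable A -> liftable B -> A x -> fib (h x) v ->
    exists2 g, lifts S h (A `|` B) g & g x = v.
  move=> ABs clA clB [m [Am Bm]] co lA lB Ax fv.
  have [g1 l1 g1x] := lA _ _ Ax fv.
  have [g2 l2 g2m] := lB _ _ Bm (lifts_fib HS l1 Am).
  have hAB : {within A `|` B, continuous h} by exact: continuous_subspaceW hc.
  have [|g [gl gA gB]] := lifts_glue HS clA clB hAB l1 l2.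
    apply: (lifts_unique HS (x0 := m) (h := h)) => //.
    - apply: continuous_subspaceW hAB => y [? _]; by left.
    - by apply: lifts_subset l1 => y [].
    - by apply: lifts_subset l2 => y [].
  by exists g => //; rewrite gA ?inE.
move=> cl1 cl2 I0 Ic L1 L2 x v [Cx|Cx] fv; first exact: key.
by rewrite setUC; apply: key => //; rewrite 1?setUC 1?setIC// setIC.
Qed.

(** Two nested inductions: strips are stacked in the second coordinate, and each thin strip is
    assembled from small rectangles in the first. A small rectangle maps into one [U], where a
    section composed with [h] is a lift. *)
Lemma lift_square : liftable (rect 0 1 0 1).
Proof.
have segc a b (u : R -> R * R) : continuous u -> connected (u @` `[a, b]).
  move=> uc; apply: connected_continuous_connected; first exact: segment_connected.
  exact: continuous_subspaceT.
pose Qv c d := liftable (rect 0 1 c d).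
apply: (@interval_induction Qv).
  move=> a b c a0 ab bc c1; rewrite /Qv -(rectU_v _ _ ab bc).
  apply: liftableU; try exact: closed_rect.
  - by rewrite rectU_v// => x /rectP[? ?]; apply/rectP; split=> //; lra.
  - by rewrite rectI_v//; exists (0, b); exists 0 => //=; rewrite in_itv/= lexx ler01.
  - rewrite rectI_v//; apply: segc => t.
    by apply: pair_cvg; [exact: cvg_id|exact: cvg_cst].
move=> y y01.
(* The admissible thickness [e] of a strip around height [y] depends on the horizontal piece; the
   smaller of two serves their union. *)
pose Qh (a b : R) := exists2 e : R, 0 < e & forall c d : R, 0 <= c -> c <= d ->
     d <= 1 -> `|c - y| < e -> `|d - y| < e -> liftable (rect a b c d).
have [|x x01|e e0 He] := @interval_induction Qh.
- move=> a b c a0 ab bc c1 [e1 e10 H1] [e2 e20 H2].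
  exists (Num.min e1 e2); first by rewrite lt_min e10.
  move=> p q p0 pq q1; rewrite !lt_min => /andP[p1 p2] /andP[q11 q2].
  rewrite -(rectU_h _ _ ab bc); apply: liftableU; try exact: closed_rect.
  + by rewrite rectU_h// => x /rectP[? ?]; apply/rectP; split=> //; lra.
  + by rewrite rectI_h//; exists (b, p); exists p => //=; rewrite in_itv/= lexx.
  + rewrite rectI_h//; apply: segc => t.
    by apply: pair_cvg; [exact: cvg_cst|exact: cvg_id].
  + exact: H1.
  + exact: H2.
- have Cxy : rect 0 1 0 1 (x, y) by apply/rectP.
  have [_ _ /(_ (h (x, y)))[U [L [Ux LS [Lth _]]]]] := HS.
  have /subspace_continuousP/(_ _ Cxy _ Ux) := hc; rewrite nbhs_simpl /= /within /=.
  move=> /nbhs_ballP[e /= e0 He]; exists e => // a b a0 ab b1 ax bx.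
  exists e => // c d c0 cd d1 cy dy p v pr fv.
  have inU z : rect a b c d z -> U (h z).
    move=> /rectP[z1 z2]; apply: He; last by apply/rectP; split; lra.
    by split; rewrite /ball/= ltr_distlC; move: ax bx cy dy; rewrite !ltr_distl; lra.
  have [s Ls sv] := Lth _ _ (inU _ pr) fv.
  exists (s \o h) => // z zr; exists U, s; split; [exact: LS|exact: inU|].
  exact: nearW.
- exists e => // a b a0 ab b1 ax bx; exact: He.
Qed.

End Square.

(** * Path lifting and monodromy *)

Section Monodromy.
Variables (R : realType) (M : topologicalType) (F : Type).
Variables (fib : M -> set F) (S : set M -> (M -> F) -> Prop).
Hypothesis HS : local_system fib S.

Definition concat (T : Type) (g1 g2 : R -> T) (t : R) : T :=
  if t <= 2^-1 then g1 (2 * t) else g2 (2 * t - 1).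

(** A path is a homotopy that does not depend on its first parameter. *)
Lemma lift_path (g : R -> M) v : {within `[0, 1], continuous g} ->
  fib (g 0) v -> exists2 u, lifts S g `[0, 1] u & u 0 = v.
Proof.
move=> gc fv.
have hc : {within rect 0 1 0 1, continuous (g \o (snd : R * R -> R))}.
  apply: (continuous_within_comp gc); last by move=> y [].
  by apply: continuous_subspaceT => y; exact: cvg_snd.
have [|G lG G0] := lift_square HS hc (x := (0, 0)) _ fv.
  by apply/rectP; rewrite /= lexx ler01.
exists (fun t => G (0, t)) => //.
have ic : {within `[0, 1], continuous (fun t : R => (0 : R, t))}.
  by apply: continuous_subspaceT => t; apply: pair_cvg; [exact: cvg_cst|exact: cvg_id].
apply: (lifts_comp ic _ lG) => t /=; rewrite in_itv/= => t01.
by apply/rectP; rewrite /= lexx ler01.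
Qed.

Lemma lifts_cst (x : M) (C : set R) u : connected C -> lifts S (cst x) C u ->
  forall s t, C s -> C t -> u s = u t.
Proof.
move=> cC lu s t Cs Ct.
have cx : {within C, continuous (cst x : R -> M)}.
  by apply: continuous_subspaceT => ?; exact: cvg_cst.
suff lc : lifts S (cst x) C (cst (u t)).
  by apply: (lifts_unique HS cC cx lu lc Ct) => //; rewrite inE.
move=> r Cr; have [U [v [? ? uv]]] := lu _ Ct; exists U, v; split=> //.
by apply: nearW => ? /=; exact: near_within_self Ct uv.
Qed.

(** Lift the homotopy to [G]. The two edges over the constant path lift to constants, and the edge
    over [d] closes up by hypothesis, so the edge over the concatenation starts and ends at the same
    value. Read from its two ends, this edge consists of the lifts of [g1] and [g2], which therefore
    meet at its midpoint. *)
Lemma monodromy (g1 g2 d : R -> M) (u1 u2 : R -> F) (x : M) :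
  homotopic x (concat g1 (fun t => g2 (1 - t))) d ->
  {within `[0, 1], continuous g1} -> {within `[0, 1], continuous g2} ->
  g1 1 = g2 1 ->
  lifts S g1 `[0, 1] u1 -> lifts S g2 `[0, 1] u2 -> u1 0 = u2 0 ->
  (forall u, lifts S d `[0, 1] u -> u 0 = u1 0 -> u 1 = u1 0) ->
  u1 1 = u2 1.
Proof.
move=> [H [Hc HH]] g1c g2c g12 l1 l2 u12 dcl.
have in0 : (0 : R) \in `[0, 1] by rewrite in_itv/= lexx ler01.
have in1 : (1 : R) \in `[0, 1] by rewrite in_itv/= lexx ler01.
have [H00 _ Hx0 _] := HH _ in0.
have g10 : g1 0 = x by rewrite -Hx0 H00 /concat invr_ge0 ler0n mulr0.
have [||G lG G00] := lift_square HS Hc (x := (0, 0)) (v := u1 0).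
- by apply/rectP; rewrite /= lexx ler01.
- by rewrite Hx0 -g10; apply: (lifts_fib HS l1).
have edge (i : R -> R * R) (e : R -> M) : continuous i ->
    (forall t, 0 <= t <= 1 -> rect 0 1 0 1 (i t) /\ H (i t) = e t) ->
    lifts S e `[0, 1] (G \o i).
  move=> ic ie.
  have ic' : {within `[0, 1], continuous i} by exact: continuous_subspaceT.
  apply: (eq_lifts (h1 := H \o i)) (lifts_comp ic' _ lG).
  - by move=> t; rewrite inE /= in_itv/= => /ie[].
  - by [].
  - by move=> t; rewrite /= in_itv/= => /ie[].
have cid : continuous (fun t : R => t) by move=> t; exact: cvg_id.
have pc (a b : R -> R) : continuous a -> continuous b ->
    continuous (fun t => (a t, b t)).
  by move=> ac bc t; apply: pair_cvg; [exact: ac|exact: bc].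
have cc (a : R) : continuous (fun _ : R => a) by move=> t; exact: cvg_cst.
have seg := @segment_connected R 0 1.
have lb : lifts S (cst x : R -> M) `[0, 1] (G \o (fun s => (s, 0))).
  apply: edge; first exact: pc.
  move=> t t01; have [|_ _ -> _] := HH t; first by rewrite in_itv.
  by split=> //; apply/rectP; rewrite /= t01 lexx ler01.
have lt : lifts S (cst x : R -> M) `[0, 1] (G \o (fun s => (s, 1))).
  apply: edge; first exact: pc.
  move=> t t01; have [|_ _ _ ->] := HH t; first by rewrite in_itv.
  by split=> //; apply/rectP; rewrite /= t01 lexx ler01.
have ld : lifts S d `[0, 1] (G \o (fun s => (1, s))).
  apply: edge; first exact: pc.
  move=> t t01; have [|_ -> _ _] := HH t; first by rewrite in_itv.
  by split=> //; apply/rectP; rewrite /= t01 lexx ler01.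
have G10 : G (1, 0) = u1 0 by rewrite -G00; exact: (lifts_cst seg lb in1 in0).
have G11 : G (1, 1) = u1 0 by exact: (dcl _ ld).
have G01 : G (0, 1) = u1 0 by rewrite -G11; exact: (lifts_cst seg lt in0 in1).
have l1' : lifts S g1 `[0, 1] (G \o (fun s => (0, s / 2))).
  apply: edge; first by apply: pc => // t; apply: cvgMl; exact: cvg_id.
  move=> t t01; split; first by apply/rectP => /=; lra.
  have [|-> _ _ _] := HH (t / 2); first by rewrite in_itv/=; lra.
  by rewrite /concat ifT; [congr g1; field|lra].
have l2' : lifts S g2 `[0, 1] (G \o (fun s => (0, 1 - s / 2))).
  apply: edge.
    apply: pc => // t; apply: cvgB; first exact: cvg_cst.
    by apply: cvgMl; exact: cvg_id.
  move=> t t01; split; first by apply/rectP => /=; lra.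
  have [|-> _ _ _] := HH (1 - t / 2); first by rewrite in_itv/=; lra.
  rewrite /concat; case: ifPn => ht; last by congr g2; field.
  have -> : t = 1 by lra.
  by rewrite -g12; congr g1; field.
have := lifts_unique HS seg g1c l1' l1 in0.
rewrite /= mul0r G00 => /(_ erefl 1); rewrite inE => /(_ in1) <-.
have := lifts_unique HS seg g2c l2' l2 in0.
rewrite /= mul0r subr0 G01 => /(_ u12 1); rewrite inE => /(_ in1) <- /=.
by congr G; congr pair; field.
Qed.

End Monodromy.

(** * The Poincare lemma in the plane *)

Section Differentials.
Variables (R : realType) (V W : normedModType R).

Lemma is_diff_approx (f : V -> W) (df : {linear V -> W}) (x : V) :
  continuous df ->
  (forall e, 0 < e -> \forall v \near 0, `|f (v + x) - f x - df v| <= e * `|v|) ->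
  is_diff x f df.
Proof.
move=> dfc fdf.
have fo : f \o shift x = cst (f x) + df +o_ 0 id.
  apply/eqaddoP => e e0; have := fdf _ e0; apply: filterS => v.
  by rewrite !fctE /= opprD addrA.
have dE := diff_unique dfc fo.
by apply: DiffDef => //; apply/diff_locallyP; rewrite dE.
Qed.

Lemma near_eq_is_diff (f g df : V -> W) (x : V) :
  (\forall y \near x, f y = g y) -> is_diff x f df -> is_diff x g df.
Proof.
move=> fg dfx; have df_diff := @ex_diff _ _ _ _ _ _ _ dfx.
rewrite -(diff_val (is_diff_def := dfx)).
apply: is_diff_approx.
  exact: diff_continuous.
move=> e e0; have [_ /eqaddoP/(_ _ e0) Ho] := (diff_locallyP x f).1 df_diff.
have fgx := nbhs_singleton fg.
have : \forall v \near 0, f (v + x) = g (v + x).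
  by move: fg; rewrite (near_shift 0 x) /=; apply: filterS => v /=; rewrite subr0.
move: Ho; apply: filterS2 => v; rewrite !fctE /= => H <-.
by rewrite -fgx -addrA -opprD.
Qed.

Lemma is_derive_line (f : V -> W) (c u : V) (s : R) :
  differentiable f (c + s *: u) ->
  is_derive s 1 (fun r : R => f (c + r *: u)) ('d f (c + s *: u) u).
Proof.
move=> fd.
have ld : is_diff s (fun r : R => c + r *: u) (fun r => r *: u).
  have -> : (fun r : R => r *: u) = 0 + (fun r => r *: u) by rewrite add0r.
  exact: (is_diffD (is_diff_cst c s) (is_diff_scalel s u)).
have dcomp : is_diff s (f \o (fun r : R => c + r *: u))
    ('d f (c + s *: u) \o (fun r => r *: u)).
  by apply: is_diff_comp; exact: differentiableP.
have dd := @ex_diff _ _ _ _ _ _ _ dcomp.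
apply: DeriveDef; first exact/derivable1_diffP.
by rewrite deriveE// (diff_val (is_diff_def := dcomp)) /= scale1r.
Qed.

End Differentials.

Section Plane.
Variable R : realType.
Local Notation mu := lebesgue_measure.

Lemma FTC_Rintegral (f F : R -> R) (a b : R) : a < b ->
  {within `[a, b], continuous f} -> {within `[a, b], continuous F} ->
  (forall x, a < x < b -> is_derive x 1 F (f x)) ->
  \int[mu]_(x in `[a, b]) f x = F b - F a.
Proof.
move=> ab fc Fc Fd.
rewrite /Rintegral (continuous_FTC2 (F := F)) //.
  have [_ Fa Fb] := (continuous_within_itvP _ ab).1 Fc.
  split=> // x; by rewrite in_itv/= => /Fd[].
by move=> x; rewrite in_itv/= => /Fd[_]; rewrite derive1E.
Qed.

Lemma norm_le1 (t : R) : 0 <= t <= 1 -> `|t| <= 1.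
Proof. by move=> t01; rewrite ler_norml; lra. Qed.

Lemma diff_scale (f : R * R -> R) (x v : R * R) (t : R) :
  'd f x (t *: v) = t * 'd f x v.
Proof. exact: linearZ. Qed.

Lemma is_derive_affine (a b s : R) : is_derive s 1 (fun s => a + s * b) b.
Proof.
have -> : (fun s => a + s * b) = cst a + b \*: (@id R).
  by apply/funext => r; rewrite !fctE /= [b *: r]mulrC.
have := is_deriveD (is_derive_cst a s 1) (is_deriveZ b (is_derive_id s 1)).
by rewrite add0r [b *: 1]mulr1.
Qed.

Lemma is_derive_dot2 (p q a b : R -> R) (s dp dq da db : R) :
  is_derive s 1 p dp -> is_derive s 1 q dq ->
  is_derive s 1 a da -> is_derive s 1 b db ->
  is_derive s 1 (fun s => p s * a s + q s * b s)
    (p s * da + dp * a s + (q s * db + dq * b s)).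
Proof.
move=> hp hq ha hb.
have := is_deriveD (is_deriveM hp ha) (is_deriveM hq hb).
rewrite /GRing.scale /= [a s * dp]mulrC [b s * dq]mulrC; exact.
Qed.

(** The covector p dx + q dy, made a linear map below so that it can serve as a differential. *)
Definition lin2 (p q : R) (v : R * R) : R := p * v.1 + q * v.2.

Lemma lin2_linear p q : linear (lin2 p q).
Proof. by move=> a u v; rewrite /lin2 /= /GRing.scale /=; ring. Qed.

HB.instance Definition _ p q :=
  GRing.isLinear.Build R (R * R)%type R _ (lin2 p q) (lin2_linear p q).

Lemma normr_fst (v : R * R) : `|v.1| <= `|v|.
Proof. by rewrite /Num.Def.normr/= le_max lexx. Qed.

Lemma normr_snd (v : R * R) : `|v.2| <= `|v|.
Proof. by rewrite /Num.Def.normr/= le_max lexx orbT. Qed.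

Lemma lin2_continuous p q : continuous (lin2 p q).
Proof.
by move=> x; apply: cvgD; apply: cvgMr; [exact: cvg_fst|exact: cvg_snd].
Qed.

Lemma norm_lin2 p q v : `|lin2 p q v| <= (`|p| + `|q|) * `|v|.
Proof.
rewrite mulrDl (le_trans (ler_normD _ _))// !normrM.
by rewrite lerD// ler_wpM2l// ?normr_fst ?normr_snd.
Qed.

(** Mean value theorem along the segment from [z] to a nearby point: the increment is given by the
    covector at an intermediate point, which is close to the one at [z] by continuity of the
    coefficients. *)
Lemma is_diff_of_directional (f p q : R * R -> R) (z : R * R) :
  {for z, continuous p} -> {for z, continuous q} ->
  (\forall w \near z, forall v, is_derive w v f (lin2 (p w) (q w) v)) ->
  is_diff z f (lin2 (p z) (q z)).
Proof.
move=> pc qc fd.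
apply: is_diff_approx; first exact: lin2_continuous.
move=> e e0.
have e20 : 0 < e / 2 by rewrite divr_gt0.
have {}pc : \forall w \near z, `|p z - p w| < e / 2.
  by have /cvgrPdist_lt/(_ _ e20) := pc.
have {}qc : \forall w \near z, `|q z - q w| < e / 2.
  by have /cvgrPdist_lt/(_ _ e20) := qc.
have : \forall w \near z, [/\ `|p z - p w| < e / 2, `|q z - q w| < e / 2 &
    forall v, is_derive w v f (lin2 (p w) (q w) v)].
  by near=> w; split; near: w.
move=> /nbhs_ballP[r /= r0 Hr].
apply/nbhs_ballP; exists r => //= v; rewrite /ball/= => vr.
have vr' : `|v| < r.
  move: vr => /=; rewrite -[X in X -> _]/(ball 0 r v) -ball_normE /ball_ /=.
  by rewrite sub0r normrN.
have inb (t : R) : 0 <= t <= 1 -> ball z r (z + t *: v).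
  move=> t01; rewrite -ball_normE /ball_/= opprD addrA subrr sub0r normrN normrZ.
  have : `|t| <= 1 by rewrite ler_norml; lra.
  by move=> t1; rewrite (le_lt_trans _ vr')// ler_piMl.
have dline (t : R) : 0 <= t <= 1 ->
    is_derive t 1 (fun t : R => f (z + t *: v))
      (lin2 (p (z + t *: v)) (q (z + t *: v)) v).
  move=> /inb /Hr[_ _ /(_ v) fv].
  have [fdv fval] := fv.
  have -> : (fun t : R => f (z + t *: v)) = (fun t : R => f (t *: v + z)).
    by apply/funext => ?; rewrite addrC.
  have E : (fun h : R => h^-1 *: (((fun s : R => f (s *: v + z)) \o shift t)
        (h *: (1 : R)) - f (t *: v + z))) =
      (fun h : R => h^-1 *: ((f \o shift (z + t *: v)) (h *: v) -
        f (z + t *: v))).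
    apply/funext => h /=; congr (_ *: (f _ - f _)); last by rewrite addrC.
    by rewrite [h%:A]mulr1 scalerDl -addrA [t *: v + z]addrC.
  apply: DeriveDef; first by rewrite /derivable E.
  by rewrite /derive E -fval.
have [||c c01] := MVT ltr01 (f := fun t : R => f (z + t *: v))
    (df := fun t => lin2 (p (z + t *: v)) (q (z + t *: v)) v).
- by move=> t; rewrite in_itv/= => t01; apply: dline; lra.
- apply: derivable_within_continuous => t; rewrite in_itv/= => /dline[] + _.
  exact.
rewrite subr0 mulr1 scale1r scale0r addr0 [z + v]addrC => ->.
have [|H1 H2 _] := Hr _ (inb c _).
  by move: c01; rewrite in_itv/=; lra.
have -> : forall a b c d, lin2 a b v - lin2 c d v = - lin2 (c - a) (d - b) v.
  by move=> *; rewrite /lin2; ring.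
rewrite normrN (le_trans (norm_lin2 _ _ _))// ler_wpM2r//.
by rewrite [leRHS]splitr lerD// ltW.
Unshelve. all: by end_near. Qed.

Lemma plane_decomp (v : R * R) : v = v.1 *: (1, 0) + v.2 *: (0, 1).
Proof.
case: v => a b; rewrite [RHS]surjective_pairing /=; congr pair.
  by rewrite [a *: 1]mulr1 scaler0 addr0.
by rewrite [b *: 1]mulr1 scaler0 add0r.
Qed.

Lemma within_comp_line (p : R * R -> R) (z0 w : R * R) (D : set R) :
  (forall t, D t -> {for z0 + t *: w, continuous p}) ->
  {within D, continuous (fun t : R => p (z0 + t *: w))}.
Proof.
move=> pc; apply: continuous_in_subspaceT => t; rewrite inE => Dt.
apply: continuous_comp; last exact: pc.
apply: cvgD; first exact: cvg_cst.
by apply: cvgZr_tmp; exact: cvg_id.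
Qed.

Lemma ball_segment (z0 z : R * R) (r t : R) : 0 <= t <= 1 ->
  ball z0 r z -> ball z0 r (z0 + t *: (z - z0)).
Proof.
move=> t01; rewrite -!ball_normE /ball_/= opprD addrA subrr sub0r normrN normrZ.
rewrite distrC; apply: le_lt_trans; rewrite ler_piMl//.
exact: norm_le1.
Qed.

Section Poincare.
Variables (p q : R * R -> R) (z0 : R * R) (r K : R).
Let B := ball z0 r.
Let ex : R * R := (1, 0).
Let ey : R * R := (0, 1).
Hypothesis r0 : 0 < r.
Hypotheses (dp : forall z, B z -> differentiable p z)
  (dq : forall z, B z -> differentiable q z).
Hypotheses (dpc : forall z v, B z -> {for z, continuous ('D_v p)})
  (dqc : forall z v, B z -> {for z, continuous ('D_v q)}).
Hypothesis pqK : forall z, B z -> [/\ `|p z| <= K, `|q z| <= K,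
  `|'D_ex p z| <= K, `|'D_ey p z| <= K & `|'D_ex q z| <= K /\ `|'D_ey q z| <= K].
Hypothesis pq : forall z, B z -> 'D_ex q z = 'D_ey p z.

Let dpE z v : B z -> 'd p z v = lin2 ('D_ex p z) ('D_ey p z) v.
Proof.
move=> /dp dpz; rewrite {1}(plane_decomp v) linearD !linearZ/= !deriveE//.
by rewrite /lin2 mulrC [_ * v.2]mulrC.
Qed.

Let dqE z v : B z -> 'd q z v = lin2 ('D_ex q z) ('D_ey q z) v.
Proof.
move=> /dq dqz; rewrite {1}(plane_decomp v) linearD !linearZ/= !deriveE//.
by rewrite /lin2 mulrC [_ * v.2]mulrC.
Qed.

Let DpE z v : B z -> 'D_v p z = lin2 ('D_ex p z) ('D_ey p z) v.
Proof. by move=> Bz; exact: etrans (deriveE v (dp Bz)) (dpE v Bz). Qed.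

Let DqE z v : B z -> 'D_v q z = lin2 ('D_ex q z) ('D_ey q z) v.
Proof. by move=> Bz; exact: etrans (deriveE v (dq Bz)) (dqE v Bz). Qed.

(** The form p dx + q dy pulled back to the segment from [z0] to [z]; its integral over [0, 1] is
    the classical primitive on a star-shaped domain. *)
Definition radial_integrand (z : R * R) (t : R) : R :=
  lin2 (p (z0 + t *: (z - z0))) (q (z0 + t *: (z - z0))) (z - z0).

Definition radial_integral (z : R * R) : R :=
  \int[mu]_(t in `[0, 1]) radial_integrand z t.

Let K0 : 0 <= K.
Proof. by have [pK _ _ _ _] := pqK (ballxx z0 r0); exact: le_trans pK. Qed.

Let line_shift (z v : R * R) (s t : R) :
  z0 + t *: (z + s *: v - z0) = z0 + t *: (z - z0) + s *: (t *: v).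
Proof. by rewrite [z + s *: v - z0]addrAC scalerDr addrA !scalerA [t * s]mulrC. Qed.

Let inB z s v t : B (z + s *: v) -> 0 <= t <= 1 ->
  B (z0 + t *: (z - z0) + s *: (t *: v)).
Proof. by move=> Bz t01; rewrite -line_shift; exact: ball_segment. Qed.

(** Closedness enters here: it makes the Jacobian matrix of (p, q) symmetric, so that [v] and
    [z - z0] can be exchanged in the second-order term. The derivative in t becomes the variation of
    [radial_integrand] in the direction [v]. *)
Lemma derive_scaled_form (z v : R * R) (t : R)
    (x := fun t : R => z0 + t *: (z - z0)) :
  B z -> 0 <= t <= 1 ->
  is_derive t 1 (fun t : R => t * lin2 (p (x t)) (q (x t)) v)
    (t * ('D_v p (x t) * (z - z0).1 + 'D_v q (x t) * (z - z0).2) +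
     lin2 (p (x t)) (q (x t)) v).
Proof.
move=> Bz t01; have Bx : B (x t) by exact: ball_segment.
have dP : is_derive t 1 (fun t : R => p (x t))
    (lin2 ('D_ex p (x t)) ('D_ey p (x t)) (z - z0)).
  by rewrite -(dpE _ Bx); exact: (is_derive_line (dp Bx)).
have dQ : is_derive t 1 (fun t : R => q (x t))
    (lin2 ('D_ex q (x t)) ('D_ey q (x t)) (z - z0)).
  by rewrite -(dqE _ Bx); exact: (is_derive_line (dq Bx)).
have sc (a : R) : is_derive t 1 (fun t : R => t * a) a.
  by have := is_derive_affine 0 a t; under [in X in X -> _]eq_fun do rewrite add0r.
have := is_derive_dot2 dP dQ (sc v.1) (sc v.2).
rewrite (DpE v Bx) (DqE v Bx) (pq Bx).
have -> : (fun s : R => p (x s) * (s * v.1) + q (x s) * (s * v.2)) =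
    (fun t : R => t * lin2 (p (x t)) (q (x t)) v).
  by apply/funext => s; rewrite /lin2; ring.
set F := (fun _ : R => _); congr (is_derive _ _ F).
rewrite /lin2; move: ('D_ex p _) ('D_ey p _) ('D_ey q _) (p _) (q _) (z - z0) => *.
ring.
Qed.

Let D z v s t : R :=
  let x := z0 + t *: (z - z0) + s *: (t *: v) in
  t * ('D_v p x * (z + s *: v - z0).1 + 'D_v q x * (z + s *: v - z0).2) +
  lin2 (p x) (q x) v.

Lemma derive_radial_integrand z v s t : B (z + s *: v) -> 0 <= t <= 1 ->
  is_derive s 1 (fun s => radial_integrand (z + s *: v) t) (D z v s t).
Proof.
move=> Bz t01; have Bx := inB Bz t01.
have -> : (fun s => radial_integrand (z + s *: v) t) =
  (fun s => p (z0 + t *: (z - z0) + s *: (t *: v)) * ((z - z0).1 + s * v.1)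
  + q (z0 + t *: (z - z0) + s *: (t *: v)) * ((z - z0).2 + s * v.2)).
  apply/funext => h; rewrite /radial_integrand /lin2.
  by rewrite !line_shift [z + h *: v - z0]addrAC.
have dP : is_derive s 1 (fun s : R => p (z0 + t *: (z - z0) + s *: (t *: v)))
    (t * 'D_v p (z0 + t *: (z - z0) + s *: (t *: v))).
  by rewrite (deriveE v (dp Bx)) -diff_scale; exact: (is_derive_line (dp Bx)).
have dQ : is_derive s 1 (fun s : R => q (z0 + t *: (z - z0) + s *: (t *: v)))
    (t * 'D_v q (z0 + t *: (z - z0) + s *: (t *: v))).
  by rewrite (deriveE v (dq Bx)) -diff_scale; exact: (is_derive_line (dq Bx)).
have := is_derive_dot2 dP dQ (is_derive_affine (z - z0).1 v.1 s)
  (is_derive_affine (z - z0).2 v.2 s).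
set F := (fun _ : R => _); congr (is_derive _ _ F).
rewrite /D [z + s *: v - z0]addrAC /lin2.
set x := z0 + _ + _; set w := z - z0.
have w1 : (w + s *: v).1 = w.1 + s * v.1 by [].
have w2 : (w + s *: v).2 = w.2 + s * v.2 by [].
rewrite w1 w2.
have alg (a b c d e1 e2 v1 v2 : R) :
    c * v1 + t * a * e1 + (d * v2 + t * b * e2) =
    t * (a * e1 + b * e2) + (c * v1 + d * v2).
  by rewrite mulrDr !mulrA addrACA addrC.
exact: alg.
Qed.

(** A constant that dominates the derivatives, for differentiation under the integral sign: (K + K)
    |v| bounds the directional derivatives and the last term, [r] bounds the coordinates of the
    displacement from [z0], and t is at most 1. *)
Lemma radial_derivative_bound z v s t : B (z + s *: v) -> 0 <= t <= 1 ->
  `|D z v s t| <= (K + K) * `|v| * r + (K + K) * `|v| * r + (K + K) * `|v|.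
Proof.
move=> Bz t01; have Bx := inB Bz t01.
have [pK qK pxK pyK [qxK qyK]] := pqK Bx.
have wr : `|z + s *: v - z0| <= r.
  by move: Bz; rewrite /B -ball_normE /ball_/= distrC => /ltW.
have dK (a b : R) : `|a| <= K -> `|b| <= K -> `|lin2 a b v| <= (K + K) * `|v|.
  by move=> aK bK; rewrite (le_trans (norm_lin2 _ _ _))// ler_wpM2r// lerD.
rewrite /D (le_trans (ler_normD _ _))// lerD//; last exact: dK.
have [pvK qvK] : `|'D_v p (z0 + t *: (z - z0) + s *: (t *: v))| <= (K + K) * `|v| /\
    `|'D_v q (z0 + t *: (z - z0) + s *: (t *: v))| <= (K + K) * `|v|.
  by split; [rewrite (DpE v Bx)|rewrite (DqE v Bx)]; exact: dK.
have w1r := le_trans (normr_fst _) wr; have w2r := le_trans (normr_snd _) wr.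
have t1 := norm_le1 t01.
move: ('D_v p _) ('D_v q _) (z + _ - z0) pvK qvK w1r w2r => dpv dqv w pvK qvK w1r w2r.
rewrite normrM -[leRHS]mul1r ler_pM// (le_trans (ler_normD _ _))// !normrM.
by rewrite lerD// ler_pM.
Qed.

Lemma radial_integral_derive z v : B z ->
  is_derive z v radial_integral (lin2 (p z) (q z) v).
Proof.
move=> Bz.
have [e e0 He] : exists2 e : R, 0 < e & forall s, `|s| < e -> B (z + s *: v).
  have : \forall s \near (0 : R), B (z + s *: v).
    have sc : {for 0, continuous (fun s : R => z + s *: v)}.
      by apply: cvgD; [exact: cvg_cst|apply: cvgZr_tmp; exact: cvg_id].
    apply: sc; rewrite scale0r addr0; apply: open_nbhs_nbhs; split=> //.
    exact: ball_open.
  by move=> /nbhs_ballP[e /= e0 He]; exists e => // s se; apply: He;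
    rewrite /ball/= sub0r normrN.
have B0 : B (z + 0 *: v) by apply: He; rewrite normr0.
have itvE (s : R) : s \in `]-e, e[ -> B (z + s *: v).
  by rewrite in_itv/= => se; apply: He; rewrite ltr_norml.
have kd (s t : R) : s \in `]-e, e[ -> t \in `[0, 1] ->
    is_derive s 1 (fun s => radial_integrand (z + s *: v) t) (D z v s t).
  by move=> /itvE Bs; rewrite in_itv/= => t01; exact: derive_radial_integrand.
have cline (f : R * R -> R) y : (forall x, B x -> {for x, continuous f}) -> B y ->
    {within `[0, 1], continuous (fun t : R => f (z0 + t *: (y - z0)))}.
  move=> fc By; apply: within_comp_line => t; rewrite /= in_itv/= => t01.
  by apply: fc; exact: ball_segment.
have pc x : B x -> {for x, continuous p} by move=> /dp/differentiable_continuous.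
have qc x : B x -> {for x, continuous q} by move=> /dq/differentiable_continuous.
have mulc (f : R -> R) (a : R) : {within `[0, 1], continuous f} ->
    {within `[0, 1], continuous (fun t => f t * a)}.
  by move=> fc t; apply: cvgMl; exact: fc.
have kc y : B y -> {within `[0, 1], continuous (radial_integrand y)}.
  move=> By t; apply: cvgD; apply: mulc; exact: cline.
pose k (s t : R) := radial_integrand (z + s *: v) t.
have e0' : (0 : R) \in `]-e, e[ by rewrite in_itv/= oppr_lt0 e0.
have cpt (f : R -> R) : {within `[0, 1], continuous f} ->
    mu.-integrable `[0, 1] (EFin \o f).
  by apply: continuous_compact_integrable; exact: segment_compact.
have L0 : 0 <= (K + K) * `|v| * r + (K + K) * `|v| * r + (K + K) * `|v|.
  by rewrite !addr_ge0// !mulr_ge0// ?addr_ge0// ltW.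
have H : h^-1 *: (radial_integral (z + (h + 0) *: v) - radial_integral (z + 0 *: v))
    @[h --> 0^'] --> \int[mu]_(t in `[0, 1]) (partial1of2 k) 0 t.
  apply: (@cvg_differentiation_under_integral R _ _ mu k `[0, 1] _ 0 (- e) e _ _ _
    (fun=> (K + K) * `|v| * r + (K + K) * `|v| * r + (K + K) * `|v|)).
  - exact: measurable_itv.
  - exact: e0'.
  - by move=> s /itvE Bs; apply: cpt; exact: kc.
  - by move=> s t /kd kd1 /kd1[].
  - by [].
  - by apply: cpt; apply: continuous_subspaceT => ?; exact: cvg_cst.
  - move=> s t se t01; have [_] := kd _ _ se t01.
    rewrite /partial1of2 derive1E => ->.
    apply: radial_derivative_bound; first exact: itvE.
    by move: t01; rewrite /= in_itv.
(* At s = 0 the integrand is the derivative of t times the form evaluated on [v] at the point of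
   parameter t. The integral is thus the value at t = 1, where that point is [z]. *)
have ktE : \int[mu]_(t in `[0, 1]) (partial1of2 k) 0 t = lin2 (p z) (q z) v.
  pose w := z - z0; pose x (t : R) := z0 + t *: w.
  pose E (t : R) := t * ('D_v p (x t) * w.1 + 'D_v q (x t) * w.2) +
    lin2 (p (x t)) (q (x t)) v.
  transitivity (\int[mu]_(t in `[0, 1]) E t).
    apply: eq_Rintegral => t; rewrite inE => t01.
    have [_] := kd _ _ e0' t01.
    rewrite /partial1of2 derive1E => ->.
    by rewrite /D /E /x !scale0r !addr0.
  pose F (t : R) := t * lin2 (p (x t)) (q (x t)) v.
  have Fd (t : R) : 0 <= t <= 1 -> is_derive t 1 F (E t) by exact: derive_scaled_form.
  transitivity (F 1 - F 0); last first.
    by rewrite /F mul1r mul0r subr0 /x scale1r /w addrC subrK.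
  apply: FTC_Rintegral; first exact: ltr01.
  - have c2 : {within `[0, 1], continuous (fun t : R => t)}.
      by apply: continuous_subspaceT => t; exact: cvg_id.
    have c3 (f : R * R -> R) : (forall y, B y -> {for y, continuous f}) ->
        {within `[0, 1], continuous (fun t => f (x t))} by move=> /cline/(_ Bz).
    have dp3 := c3 _ (fun y => @dpc y v); have dq3 := c3 _ (fun y => @dqc y v).
    have p3 := c3 _ pc; have q3 := c3 _ qc.
    move=> t; apply: cvgD.
      apply: cvgM; first exact: c2.
      by apply: cvgD; [exact: (mulc _ w.1 dp3)|exact: (mulc _ w.2 dq3)].
    by apply: cvgD; [exact: (mulc _ v.1 p3)|exact: (mulc _ v.2 q3)].
  - by apply: derivable_within_continuous => t; rewrite in_itv/= => /Fd[].
  - by move=> t t01; apply: Fd; lra.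
have HE : (fun h : R => h^-1 *:
      ((radial_integral \o shift z) (h *: v) - radial_integral z)) =
    (fun h : R => h^-1 *:
      (radial_integral (z + (h + 0) *: v) - radial_integral (z + 0 *: v))).
  by apply/funext => h; rewrite /= addr0 scale0r addr0 [z + _]addrC.
rewrite ktE -HE in H.
apply: DeriveDef; first by apply/cvg_ex; eexists; exact: H.
exact: cvg_lim H.
Qed.

End Poincare.

(** Continuity at [z0] bounds the coefficients and their partial derivatives on a small ball, which
    supplies the domination for the radial integral; continuity of [p] and [q] then upgrades
    directional derivatives to a differential. *)
Lemma poincare (p q : R * R -> R) (U : set (R * R)) (z0 : R * R) :
  open U -> U z0 ->
  (forall z, U z -> differentiable p z /\ differentiable q z) ->
  (forall z v, U z -> {for z, continuous ('D_v p)} /\ {for z, continuous ('D_v q)}) ->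
  (forall z, U z -> 'D_(1, 0) q z = 'D_(0, 1) p z) ->
  exists2 r : R, 0 < r & ball z0 r `<=` U /\
    exists f : R * R -> R, forall z, ball z0 r z -> is_diff z f (lin2 (p z) (q z)).
Proof.
move=> oU Uz0 dpq dpqc pq.
have bnd (f : R * R -> R) : {for z0, continuous f} ->
    exists2 K : R, 0 <= K & \forall z \near z0, `|f z| <= K.
  move=> /cvgrPdist_lt/(_ _ ltr01) H; exists (`|f z0| + 1); first by rewrite addr_ge0.
  apply: filterS H => z H; rewrite -(subKr (f z0) (f z)).
  by rewrite (le_trans (ler_normB _ _))// lerD2l ltW.
have [dp dq] := dpq _ Uz0.
have [K1 K10 H1] := bnd _ (differentiable_continuous dp).
have [K2 K20 H2] := bnd _ (differentiable_continuous dq).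
have [K3 K30 H3] := bnd _ (dpqc z0 (1, 0) Uz0).1.
have [K4 K40 H4] := bnd _ (dpqc z0 (0, 1) Uz0).1.
have [K5 K50 H5] := bnd _ (dpqc z0 (1, 0) Uz0).2.
have [K6 K60 H6] := bnd _ (dpqc z0 (0, 1) Uz0).2.
pose K := K1 + K2 + K3 + K4 + K5 + K6.
have : \forall z \near z0, U z /\ [/\ `|p z| <= K, `|q z| <= K,
    `|'D_(1, 0) p z| <= K, `|'D_(0, 1) p z| <= K &
    `|'D_(1, 0) q z| <= K /\ `|'D_(0, 1) q z| <= K].
  have nU : \forall z \near z0, U z by apply: open_nbhs_nbhs.
  near=> z; split; first by near: z.
  split; last split.
  - by apply: (@le_trans _ _ K1); [near: z|rewrite /K; lra].
  - by apply: (@le_trans _ _ K2); [near: z|rewrite /K; lra].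
  - by apply: (@le_trans _ _ K3); [near: z|rewrite /K; lra].
  - by apply: (@le_trans _ _ K4); [near: z|rewrite /K; lra].
  - by apply: (@le_trans _ _ K5); [near: z|rewrite /K; lra].
  - by apply: (@le_trans _ _ K6); [near: z|rewrite /K; lra].
move=> /nbhs_ballP[r /= r0 Hr]; exists r => //.
split; first by move=> z /Hr[].
exists (radial_integral p q z0) => z Bz.
have inU x : ball z0 r x -> U x by move=> /Hr[].
apply: is_diff_of_directional.
- exact: (differentiable_continuous (dpq _ (inU _ Bz)).1).
- exact: (differentiable_continuous (dpq _ (inU _ Bz)).2).
- have : \forall w \near z, ball z0 r w.
    by apply: open_nbhs_nbhs; split=> //; exact: ball_open.
  apply: filterS => w Bw v; apply: (@radial_integral_derive _ _ _ r K) => //.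
  + by move=> x /inU/dpq[].
  + by move=> x /inU/dpq[].
  + by move=> x u /inU/(dpqc _ u)[].
  + by move=> x u /inU/(dpqc _ u)[].
  + by move=> x /Hr[].
  + by move=> x /inU/pq.
Unshelve. all: by end_near. Qed.

Lemma zero_diff_constant (f : R * R -> R) (z0 : R * R) (r : R) :
  (forall z, ball z0 r z -> is_diff z f 0) ->
  forall z, ball z0 r z -> f z = f z0.
Proof.
move=> fd z Bz; pose g (t : R) := f (z0 + t *: (z - z0)).
have gd (t : R) : 0 <= t <= 1 -> is_derive t 1 g 0.
  move=> /ball_segment/(_ Bz)/fd [dz dz0].
  have := is_derive_line dz; rewrite dz0; exact.
have [||c c01] := MVT ltr01 (f := g) (df := fun=> 0).
- by move=> t; rewrite in_itv/= => t01; apply: gd; lra.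
- by apply: derivable_within_continuous => t; rewrite in_itv/= => /gd[].
rewrite /g scale1r scale0r addr0 mul0r [z0 + _]addrC subrK => /eqP.
by rewrite subr_eq0 => /eqP.
Qed.

End Plane.

(** * Primitives and sections of coverings as locally constant sheaves *)

Section RowDifferentials.
Variables (R : realType) (V : normedModType R) (n : nat).

Lemma is_diff_coord (f df : V -> 'rV[R]_n) (x : V) (j : 'I_n) :
  is_diff x f df -> is_diff x (fun y => f y 0 j) (fun v => df v 0 j).
Proof.
move=> fd.
(* The coordinate function is bundled as a linear map, hence is its own differential. *)
have @c : {linear 'rV[R]_n -> R}.
  by exists (fun N : 'rV[R]_n => N 0 j); do 2![eexists]; do ?[constructor];
     rewrite ?mxE// => ? *; rewrite ?mxE//; move=> ?; rewrite !mxE.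
have cc : continuous c by move=> ?; exact: coord_continuous.
have cd : is_diff (f x) (c : 'rV[R]_n -> R) c.
  by apply: DiffDef; [exact: linear_differentiable|exact: diff_lin].
exact: (is_diff_comp fd cd).
Qed.

Lemma is_diff_row (f df : 'I_n -> V -> R) (x : V) :
  (forall j, is_diff x (f j) (df j)) ->
  is_diff x (fun y => \row_j f j y) (fun v => \row_j df j v).
Proof.
move=> fd.
have dF : differentiable (fun y => \row_j f j y) x.
  have -> : (fun y => \row_j f j y) =
      \sum_(j < n) (fun y => f j y *: delta_mx (0 : 'I_1) j).
    apply/funext => y; rewrite fct_sumE [LHS]row_sum_delta.
    by apply: eq_bigr => j _; rewrite mxE.
  by apply: differentiable_sum => j; apply: differentiableZl; apply: ex_diff.
apply: DiffDef => //; apply/funext => v; apply/rowP => j; rewrite mxE.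
have := is_diff_coord j (differentiableP dF) => -[_ /(congr1 (fun g => g v)) <-].
have [_ /(congr1 (fun g => g v)) <-] := fd j.
by congr (diff _ _ v); apply/funext => y; rewrite mxE.
Qed.

End RowDifferentials.

Lemma zero_diff_constant_row (R : realType) (n : nat) (f : R * R -> 'rV[R]_n)
    (z0 : R * R) (r : R) :
  (forall z, ball z0 r z -> is_diff z f 0) ->
  forall z, ball z0 r z -> f z = f z0.
Proof.
move=> fd z Bz; apply/rowP => j.
apply: (zero_diff_constant (f := fun z => f z 0 j) _ Bz) => y By.
have := is_diff_coord j (fd _ By).
by congr (is_diff_def _ _ _); apply/funext => v; rewrite mxE.
Qed.

Section Charts.
Variables (R : realType) (M : topologicalType).
Implicit Types c d : chart R M.

Lemma cmapK c q : is_chart c -> cdom c q -> cinv c (cmap c q) = q.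
Proof. by move=> [_ _ cK _ _]; exact: cK. Qed.

Lemma cinv_cimg c z : is_chart c -> cimg c z ->
  cdom c (cinv c z) /\ cmap c (cinv c z) = z.
Proof. by move=> [_ _ cK _ _] [q cq <-]; rewrite cK. Qed.

Lemma cimg_cmap c q : cdom c q -> cimg c (cmap c q).
Proof. by move=> cq; exists q. Qed.

Lemma cinv_continuous c z : is_chart c -> cimg c z -> {for z, continuous (cinv c)}.
Proof.
move=> [_ oI _ _]; rewrite continuous_open_subspace// => H Iz.
by apply: H; rewrite inE.
Qed.

Lemma cmap_continuous c q : is_chart c -> cdom c q -> {for q, continuous (cmap c)}.
Proof.
move=> [oD _ _ + _]; rewrite continuous_open_subspace// => H Iz.
by apply: H; rewrite inE.
Qed.

Lemma near_cimg c z : is_chart c -> cimg c z -> \forall w \near z, cimg c w.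
Proof. by move=> [_ oI _ _ _] Iz; exact: open_nbhs_nbhs. Qed.

Lemma near_cdom c q : is_chart c -> cdom c q -> \forall r \near q, cdom c r.
Proof. by move=> [oD _ _ _ _] Iz; exact: open_nbhs_nbhs. Qed.

Lemma near_cinv c q (P : M -> Prop) : is_chart c -> cdom c q ->
  (\forall r \near q, P r) -> \forall w \near cmap c q, P (cinv c w).
Proof.
move=> ch cq nP; have Iq := cimg_cmap cq.
by have := cinv_continuous ch Iq; apply; rewrite cmapK.
Qed.

Lemma near_cmap c q (P : R * R -> Prop) : is_chart c -> cdom c q ->
  (\forall w \near cmap c q, P w) -> \forall r \near q, P (cmap c r).
Proof. by move=> ch cq; exact: cmap_continuous. Qed.

End Charts.

Section Primitives.
Variables (R : realType) (M : topologicalType) (A : set (chart R M)) (n : nat).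
Hypothesis hA : complex_atlas A.
Variable alpha : one_form R M 'rV[R]_n.

(** The conditions of [is_form], transposed from complex to real row vectors. *)
Definition real_form :=
  (forall c q, A c -> cdom c q -> forall (a : R) (u v : R * R),
     alpha c q (a *: u + v) = a *: alpha c q u + alpha c q v) /\
  (forall c d q, A c -> A d -> cdom c q -> cdom d q -> forall v : R * R,
     alpha c q v = alpha d q ('d (cmap d \o cinv c) (cmap c q) v)).

Definition is_primitive (U : set M) (f : M -> 'rV[R]_n) :=
  open U /\ forall c q, A c -> U q -> cdom c q ->
    is_diff (cmap c q) (f \o cinv c) (alpha c q).

Hypotheses (ha : real_form) (hs : smooth_form A alpha) (hc : closed_form A alpha).

Let chartA c : A c -> is_chart c. Proof. by case: hA => + _ _; apply. Qed.

Lemma formE c q v : A c -> cdom c q ->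
  alpha c q v = v.1 *: alpha c q (1, 0) + v.2 *: alpha c q (0, 1).
Proof.
move=> Ac cq; have [lin _] := ha.
have a0 : alpha c q 0 = 0.
  by have := lin _ _ Ac cq (-1) 0 0; rewrite scaler0 addr0 scaleN1r addNr.
have vE : v = v.1 *: (1, 0) + (v.2 *: (0, 1) + 0).
  by rewrite addr0 -plane_decomp.
by rewrite {1}vE lin// lin// a0 addr0.
Qed.

Lemma primitiveD_cst U f v : is_primitive U f -> is_primitive U (fun x => f x + v).
Proof.
move=> [oU fp]; split; first exact: oU.
move=> c q Ac Uq cq.
have := is_diffD (fp _ _ Ac Uq cq) (is_diff_cst v (cmap c q)).
by rewrite addr0.
Qed.

(** In a chart, the difference of the two primitives has zero differential on a ball, hence is
    constant there, and it vanishes at [x]. *)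
Lemma primitive_germ U f V g x : is_primitive U f -> is_primitive V g ->
  U x -> V x -> f x = g x -> \forall y \near x, f y = g y.
Proof.
move=> [oU fp] [oV gp] Ux Vx fgx.
have [_ /(_ x)[c Ac cx] _] := hA.
have ch := chartA Ac.
have nUV : \forall y \near x, U y /\ V y.
  by apply: open_nbhs_nbhs; split; [exact: openI|split].
have : \forall w \near cmap c x, cimg c w /\ (U (cinv c w) /\ V (cinv c w)).
  by apply: filterI; [exact: near_cimg (cimg_cmap cx)|exact: near_cinv nUV].
move=> /nbhs_ballP[r /= r0 Hr].
have const w : ball (cmap c x) r w -> f (cinv c w) - g (cinv c w) =
    f (cinv c (cmap c x)) - g (cinv c (cmap c x)).
  suff H z : ball (cmap c x) r z -> is_diff z ((f \o cinv c) - (g \o cinv c)) 0.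
    by move=> Bw; have := zero_diff_constant_row H Bw.
  move=> /Hr[Iz [Uz Vz]]; have [cz czE] := cinv_cimg ch Iz.
  have := is_diffB (fp _ _ Ac Uz cz) (gp _ _ Ac Vz cz).
  by rewrite czE subrr.
have nB : \forall y \near x, ball (cmap c x) r (cmap c y).
  by apply: near_cmap => //; exact: nbhsx_ballx.
move: nB (near_cdom ch cx); apply: filterS2 => y /const + cy.
by rewrite !(cmapK ch)// fgx subrr => /eqP; rewrite subr_eq0 => /eqP.
Qed.

Lemma chart_component_smooth c v j : A c ->
  let g z := alpha c (cinv c z) v 0 j in
  (forall z, cimg c z -> differentiable g z) /\
  (forall z w, cimg c z ->
     'D_w g z = 'D_w (fun z => alpha c (cinv c z) v) z 0 j /\
     {for z, continuous ('D_w g)}).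
Proof.
move=> Ac g; have ch := chartA Ac.
have [da sa] := hs Ac v 1%N.
have dg z : cimg c z -> differentiable g z.
  by move=> /da/differentiableP/(@is_diff_coord _ _ _ _ _ _ j)[].
have Dg z w : cimg c z ->
    'D_w g z = 'D_w (fun z => alpha c (cinv c z) v) z 0 j.
  move=> Iz; rewrite (deriveE _ (dg _ Iz)) (deriveE _ (da _ Iz)).
  have := is_diff_coord j (differentiableP (da _ Iz)).
  by move=> [_ /(congr1 (fun h => h w))].
split=> // z w Iz; split; first exact: Dg.
have sz : {for z, continuous (fun z => 'D_w (fun z => alpha c (cinv c z) v) z 0 j)}.
  exact: (cvg_comp _ (fun N : 'rV[R]_n => N 0 j) (sa w z Iz)
    (@coord_continuous _ _ _ 0 j _)).
move: sz; rewrite /prop_for /continuous_at Dg//; apply: cvg_trans.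
apply: near_eq_cvg; near=> y; rewrite Dg//; near: y; exact: near_cimg.
Unshelve. all: by end_near. Qed.

(** The Poincare lemma is applied to each component in one chart; the other charts follow from the
    chain rule and the transformation law of [alpha]. *)
Lemma primitive_exists x : exists2 U, U x & exists f, is_primitive U f.
Proof.
have [_ /(_ x)[c Ac cx] hol] := hA.
have ch := chartA Ac.
pose P j (z : R * R) := alpha c (cinv c z) (1, 0) 0 j.
pose Q j (z : R * R) := alpha c (cinv c z) (0, 1) 0 j.
have oI : open (cimg c) by case: ch.
have /choice[rf Hrf] : forall j, exists rf : R * (R * R -> R), [/\ 0 < rf.1,
    ball (cmap c x) rf.1 `<=` cimg c &
    forall z, ball (cmap c x) rf.1 z -> is_diff z rf.2 (lin2 (P j z) (Q j z))].
  move=> j; have [dP DP] := chart_component_smooth (1, 0) j Ac.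
  have [dQ DQ] := chart_component_smooth (0, 1) j Ac.
  have [||||r r0 [rI [f fd]]] := @poincare R (P j) (Q j) (cimg c) (cmap c x) oI.
  - exact: cimg_cmap.
  - by move=> z Iz; split; [exact: dP|exact: dQ].
  - by move=> z v Iz; split; [case: (DP z v Iz)|case: (DQ z v Iz)].
  - move=> z Iz; have [-> _] := DQ z (1, 0) Iz; have [-> _] := DP z (0, 1) Iz.
    by rewrite (hc Ac Iz).
  - by exists (r, f).
(* The radius depends on the component; the default 1 keeps the minimum positive when n = 0. *)
pose r := \big[Num.min/1]_(j < n) (rf j).1.
have r0 : 0 < r by apply: lt_bigmin => // j _; case: (Hrf j).
have rle j : r <= (rf j).1 by exact: bigmin_le.
pose F z := \row_j (rf j).2 z.
exists (cdom c `&` cmap c @^-1` ball (cmap c x) r).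
  by split=> //; exact: ballxx.
exists (F \o cmap c); split.
  have [oD _ _ cc _] := ch.
  move: cc; rewrite continuous_open_subspace// => /(continuous_inP _ oD); apply.
  exact: ball_open.
move=> d q Ad [cq qr] dq.
have FD : is_diff (cmap c q) F (alpha c q).
  have : is_diff (cmap c q) F (fun v => \row_j lin2 (P j (cmap c q)) (Q j (cmap c q)) v).
    apply: is_diff_row => j; have [_ _] := Hrf j; apply.
    exact: le_ball qr.
  congr (is_diff_def _ _ _); apply/funext => v; apply/rowP => j.
  rewrite (formE v Ac cq) !mxE /P /Q /lin2.
  by have -> : cinv c (cmap c q) = q by [exact: cmapK]; rewrite mulrC [X in _ + X]mulrC.
have holq : differentiable (cmap c \o cinv d) (cmap d q).
  by have [] := hol d c Ad Ac (cmap d q); first by exists q.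
have dK : cinv d (cmap d q) = q by exact: cmapK (chartA Ad) dq.
have FD' : is_diff ((cmap c \o cinv d) (cmap d q)) F (alpha c q) by rewrite /= dK.
have := is_diff_comp (differentiableP holq) FD'.
congr (is_diff_def _ _ _); apply/funext => v /=.
by have [_ /(_ d c q Ad Ac dq cq v) ->] := ha.
Qed.

Lemma primitive_system : local_system (fun=> setT) is_primitive.
Proof.
split=> //.
- move=> U f V g x; exact: primitive_germ.
- move=> x; have [U Ux [f fp]] := primitive_exists x.
  (* The translates of one primitive: every value occurs at every point, and two translates that
     meet have the same constant. *)
  exists U, [set g | exists v, g = fun y => f y + v]; split.
  + by apply: open_nbhs_nbhs; split=> //; case: fp.
  + by move=> _ [v ->]; exact: primitiveD_cst.
  + split=> [y v Uy _|_ _ y [v ->] [w ->] Uy].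
      by exists (fun z => f z + (v - f y)); [exists (v - f y)|rewrite addrC subrK].
    by move=> /addrI -> z.
Qed.

Lemma subdivision_le (gamma : R -> M) t0 s t1 :
  subdivision A gamma t0 s t1 -> t0 <= t1.
Proof.
elim: s t0 => [t0 /= ->//|a s IH t0 /= [<- [ltab _ _ _] /IH]].
by apply: le_trans; exact: ltW.
Qed.

(** A lift is locally a primitive composed with the coordinates of the path, so its derivative is
    the integrand. *)
Lemma arc_integral_lift (gamma : R -> M) (a : smooth_arc R M) (g : R -> 'rV[R]_n) :
  arc_of A gamma a -> lifts is_primitive gamma `[asrc a, atgt a] g ->
  arc_integral alpha gamma a = g (atgt a) - g (asrc a).
Proof.
case: a => a b c u [/= ab Ac us uE] gl.
have ch := chartA Ac.
have [ud uc] := us 1%N.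
have {}ud t : differentiable u t by exact: ud.
have uD1 : derive1 u = 'D_1 u by apply/funext => t; rewrite derive1E.
have {}uc t : {for t, continuous (derive1 u)} by rewrite uD1; exact: uc.
have gE t : t \in `[a, b] -> [/\ cdom c (gamma t), cimg c (u t), cmap c (gamma t) = u t &
    cinv c (u t) = gamma t].
  move=> tab; have [dt ut] := uE _ tab.
  by split; [exact: dt|rewrite -ut; exact: cimg_cmap|exact: ut|rewrite -ut (cmapK ch dt)].
(* As [g] is controlled only on [a, b], it is compared with a function [w] that is differentiable at
   t on the whole line; at the endpoints the two need agree only from inside. *)
have wE t : t \in `[a, b] -> exists2 w : R -> 'rV[R]_n,
    is_diff t w (fun s => alpha c (gamma t) ('d u t s)) &
    \forall y \near within `[a, b] (nbhs t), g y = w y.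
  move=> tab; have [U [f [[oU fp] Ut gf]]] := gl _ tab.
  have [dt It utE ut] := gE _ tab.
  exists ((f \o cinv c) \o u).
    have fd := fp _ _ Ac Ut dt; rewrite utE in fd.
    exact: (is_diff_comp (differentiableP (ud t)) fd).
  apply/near_withinP; move/near_withinP: gf; apply: filterS => y gf yab.
  by have [_ _ _ /= ->] := gE _ yab; exact: gf.
apply/rowP => j; rewrite !mxE.
change (\int[lebesgue_measure]_(t in `[a, b]) alpha c (gamma t) (derive1 u t) 0 j =
  g b 0 j - g a 0 j).
apply: (FTC_Rintegral (F := fun t => g t 0 j)).
- exact: ab.
(* Regularity of [alpha] is known for fixed tangent vectors only, so the integrand is expanded in
   the basis (1, 0), (0, 1). *)
- suff H : {within `[a, b], continuous (fun t =>
      (derive1 u t).1 * alpha c (cinv c (u t)) (1, 0) 0 j +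
      (derive1 u t).2 * alpha c (cinv c (u t)) (0, 1) 0 j)}.
    apply: subspace_eq_continuous H => t; rewrite inE => tab.
    have [dt _ _ ut] := gE _ tab.
    change ((derive1 u t).1 * alpha c (cinv c (u t)) (1, 0) 0 j +
      (derive1 u t).2 * alpha c (cinv c (u t)) (0, 1) 0 j =
      alpha c (gamma t) (derive1 u t) 0 j).
    rewrite ut.
    have /(congr1 (fun r : 'rV[R]_n => r 0 j)) := formE (derive1 u t) Ac dt.
    by rewrite !mxE => ->.
  have cP v t : t \in `[a, b] ->
      {for t, continuous (fun t => alpha c (cinv c (u t)) v 0 j)}.
    move=> /gE[_ Iu _ _]; have [dP _] := chart_component_smooth v j Ac.
    have := differentiable_continuous (dP _ Iu).
    by apply: continuous_comp; exact: differentiable_continuous.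
  apply: continuous_in_subspaceT => t; rewrite inE => tab.
  apply: cvgD; apply: cvgM; try exact: cP.
    by apply: (cvg_comp _ _ (uc t)); exact: cvg_fst.
  by apply: (cvg_comp _ _ (uc t)); exact: cvg_snd.
- apply/subspace_continuousP => t tab.
  have [w wd gw] := wE _ tab.
  have [dw _] := is_diff_coord j wd.
  have := differentiable_continuous dw.
  rewrite /prop_for /continuous_at -(near_within_self tab gw) => wc.
  have {}wc : w y 0 j @[y --> within `[a, b] (nbhs t)] --> g t 0 j.
    exact: cvg_within_filter wc.
  apply: (cvg_trans _ wc); apply: near_eq_cvg.
  by apply: filterS gw => y gy; exact: (congr1 (fun r : 'rV[R]_n => r 0 j) (esym gy)).
- move=> t tab.
  have tab' : t \in `[a, b].
    by rewrite in_itv/=; case/andP: tab => /ltW-> /ltW->.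
  have [w wd gw] := wE _ tab'.
  have gw' : \forall y \near t, w y 0 j = g y 0 j.
    have nab : \forall y \near t, y \in `[a, b].
      have : \forall y \near t, y \in `]a, b[ by apply: near_in_itvoo; rewrite in_itv.
      by apply: filterS => y; rewrite !in_itv/= => /andP[/ltW-> /ltW->].
    by move/near_withinP: gw nab; apply: filterS2 => y H /H ->.
  have [gd gdE] := near_eq_is_diff gw' (is_diff_coord j wd).
  apply: DeriveDef; first exact/derivable1_diffP.
  rewrite (deriveE _ gd) gdE.
  by congr (alpha c _ _ 0 j); rewrite derive1E (deriveE _ (ud t)).
Qed.

(** Telescoping over the arcs. This is the bridge from lifts, which exist along every continuous
    path, to integrals along piecewise smooth ones. *)
Lemma sub_integral_lift (gamma : R -> M) t0 s t1 (g : R -> 'rV[R]_n) :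
  subdivision A gamma t0 s t1 -> lifts is_primitive gamma `[t0, t1] g ->
  sub_integral alpha gamma s = g t1 - g t0.
Proof.
elim: s t0 => [t0 /= -> _|a s IH t0 /= [<- aa sub] gl].
  by rewrite /sub_integral big_nil subrr.
have le1 := subdivision_le sub.
have [lt0 _ _ _] := aa.
rewrite /sub_integral big_cons (arc_integral_lift (g := g) aa); last first.
  by apply: lifts_subset gl => t; rewrite /= !in_itv/=; lra.
rewrite [X in _ + X](IH _ sub); last first.
  by apply: lifts_subset gl => t; rewrite /= !in_itv/=; lra.
by rewrite addrC addrA subrK.
Qed.

End Primitives.

(** * The sheaf of sections of a covering *)

Section CoveringSystem.
Variables (M N : topologicalType) (p : N -> M).
Hypothesis hp : covering p.

Definition is_section (U : set M) (s : M -> N) :=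
  open U /\ forall x, U x -> {for x, continuous s} /\ p (s x) = x.

Lemma sheet_section U V : open U -> is_sheet p U V ->
  exists s, [/\ is_section U s, (forall x, U x -> V (s x)) &
    forall y, V y -> U (p y) /\ s (p y) = y].
Proof.
move=> oU [s [sV Vs sc]]; exists s; split=> //; last by move=> x /sV[].
split=> // x Ux; split; last by case: (sV _ Ux).
move: sc; rewrite continuous_open_subspace// => sc.
by apply: sc; rewrite inE.
Qed.

(** Over an evenly covered set, [L] consists of the sections with all their values in one sheet, a
    condition that replaces connectedness of [U]. By disjointness of the sheets, two such sections
    with a common value use the same sheet, and [p] is injective on it. *)
Lemma covering_system : local_system (fun x => [set y | p y = x]) is_section.
Proof.
have [pc pF] := hp.
split.
- by move=> U s x [_ sp] /sp[].
- move=> U s V t x [oU sp] [oV tp] Ux Vx sx.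
  have [U0 [oU0 U0x [F [Ftriv FU FV]]]] := pF x.
  have [W FW Ws] : exists2 W, F W & W (s x).
    have : (p @^-1` U0) (s x) by rewrite /preimage /= (sp _ Ux).2.
    by rewrite -FU => -[W ? ?]; exists W.
  have [oW /(sheet_section oU0)[r [_ _ rW]]] := FV _ FW.
  have ns : \forall y \near x, W (s y).
    by apply: (sp _ Ux).1; exact: open_nbhs_nbhs.
  have nt : \forall y \near x, W (t y).
    by apply: (tp _ Vx).1; rewrite -sx; exact: open_nbhs_nbhs.
  have nUV : \forall y \near x, U y /\ V y.
    by apply: open_nbhs_nbhs; split; [exact: openI|split].
  near=> y.
  have [Uy Vy] : U y /\ V y by near: y.
  have Wsy : W (s y) by near: y.
  have Wty : W (t y) by near: y.
  have [_ <-] := rW _ Wsy; have [_ <-] := rW _ Wty.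
  by rewrite (sp _ Uy).2 (tp _ Vy).2.
- move=> x; have [U [oU Ux [F [Ftriv FU FV]]]] := pF x.
  exists U, [set s | is_section U s /\ exists2 V, F V & forall x, U x -> V (s x)].
  split; [exact: open_nbhs_nbhs|by move=> s []|split].
    move=> z y Uz /= pyz.
    have [W FW Wy] : exists2 W, F W & W y.
      have : (p @^-1` U) y by rewrite /preimage /= pyz.
      by rewrite -FU => -[W ? ?]; exists W.
    have [oW /(sheet_section oU)[r [rs rU rW]]] := FV _ FW.
    by exists r; [split=> //; exists W|rewrite -pyz; case: (rW _ Wy)].
  move=> s t z [[_ sp] [V FV1 sV]] [[_ tp] [W FW tW]] Uz st w; rewrite inE => Uw.
  have VW : V = W.
    by apply: (Ftriv _ _ FV1 FW); exists (s z); split; [exact: sV|rewrite st; exact: tW].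
  have [oV /(sheet_section oU)[r [_ _ rV]]] := FV _ FV1.
  have [_ <-] := rV _ (sV _ Uw).
  have Vtw : V (t w) by rewrite VW; exact: tW.
  have [_ <-] := rV _ Vtw.
  by rewrite (sp _ Uw).2 (tp _ Uw).2.
Unshelve. all: by end_near. Qed.

(** Near each point a continuous map stays in a single sheet, where it is recovered from its
    projection by the inverse of [p]. *)
Lemma continuous_lifts (T : topologicalType) (C : set T) (e : T -> N) :
  {within C, continuous e} -> lifts is_section (p \o e) C e.
Proof.
move=> /subspace_continuousP ec x Cx; have [pc pF] := hp.
have [U [oU Ux [F [Ftriv FU FV]]]] := pF (p (e x)).
have [W FW Wy] : exists2 W, F W & W (e x).
  have : (p @^-1` U) (e x) by [].
  by rewrite -FU => -[W ? ?]; exists W.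
have [oW /(sheet_section oU)[r [rs rU rW]]] := FV _ FW.
exists U, r; split=> //.
have nW : \forall y \near e x, W y by exact: open_nbhs_nbhs.
have := ec _ Cx _ nW; rewrite nbhs_simpl /=.
by apply: filterS => y /rW[_].
Qed.

End CoveringSystem.

(** * Loops are homotopic to piecewise smooth loops *)

Section SmoothLines.
Variables (R : realType) (V W : normedModType R).

Lemma Ck_on_cst k (U : set V) (w : W) : Ck_on k U (cst w).
Proof.
elim: k w => [w x _|k IH w]; first exact: cvg_cst.
split=> [x _|v]; first exact: differentiable_cst.
have -> : 'D_v (cst w : V -> W) = cst 0 by apply/funext => x; rewrite derive_cst.
exact: IH.
Qed.

End SmoothLines.

Lemma smooth_on_line (R : realType) (W : normedModType R) (c u : W) :
  smooth_on (setT : set R) (fun t : R => c + t *: u).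
Proof.
have ld (t : R) : is_diff t (fun t : R => c + t *: u) (fun r => r *: u).
  have -> : (fun r : R => r *: u) = 0 + (fun r => r *: u) by rewrite add0r.
  exact: (is_diffD (is_diff_cst c t) (is_diff_scalel t u)).
move=> [|k].
  by move=> t _; have [/differentiable_continuous] := ld t.
split=> [t _|v]; first by have [] := ld t.
have -> : 'D_v (fun t : R => c + t *: u) = cst (v *: u).
  by apply/funext => t; have [dt dtE] := ld t; rewrite (deriveE _ dt) dtE.
exact: Ck_on_cst.
Qed.

Section PiecewiseSmooth.
Variables (R : realType) (M : topologicalType) (A : set (chart R M)).
Hypothesis hA : complex_atlas A.

Lemma ball_convex (z0 u v : R * R) (r s : R) : 0 <= s <= 1 ->
  ball z0 r u -> ball z0 r v -> ball z0 r ((1 - s) *: u + s *: v).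
Proof.
move=> s01; rewrite -!ball_normE /ball_/= => hu hv.
have -> : z0 - ((1 - s) *: u + s *: v) = (1 - s) *: (z0 - u) + s *: (z0 - v).
  by rewrite !scalerBr addrACA -scalerDl subrK scale1r -opprD.
rewrite (le_lt_trans (ler_normD _ _))// !normrZ !ger0_norm; [|lra|lra].
have [->|s0] := eqVneq s 0; first by rewrite mul0r addr0 subr0 mul1r.
have -> : r = (1 - s) * r + s * r by rewrite -mulrDl subrK mul1r.
apply: ler_ltD; first by apply: ler_wpM2l; [lra|exact: ltW].
by rewrite ltr_pM2l// lt_neqAle eq_sym s0; lra.
Qed.

Lemma subdivision_eq (g g' : R -> M) t0 s t1 :
  (forall t, t0 <= t <= t1 -> g t = g' t) ->
  subdivision A g t0 s t1 -> subdivision A g' t0 s t1.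
Proof.
elim: s t0 => [//|a s IH t0 /= gE [at0 aa sub]].
have le1 := subdivision_le sub; have [ab Ac us uE] := aa.
split=> //.
  split=> // t tab; have := uE _ tab; rewrite gE//.
  by move: tab ab le1; rewrite -at0 in_itv/=; lra.
apply: IH sub => t tab; apply: gE; move: ab; rewrite -at0; lra.
Qed.

Lemma subdivision_cat (g : R -> M) t0 s t1 s' t2 :
  subdivision A g t0 s t1 -> subdivision A g t1 s' t2 ->
  subdivision A g t0 (s ++ s') t2.
Proof.
elim: s t0 => [t0 /= ->//|a s IH t0 /= [? ? /IH H] /H].
by split.
Qed.

(** The homotopy fixes both endpoints, which is what allows homotopies over consecutive intervals to
    be glued. *)
Definition smoothable (g : R -> M) (a b : R) :=
  exists (d : R -> M) s (H : R * R -> M),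
    [/\ subdivision A d a s b, {within rect 0 1 a b, continuous H},
        (forall t, a <= t <= b -> H (0, t) = g t /\ H (1, t) = d t) &
        (forall s, 0 <= s <= 1 -> H (s, a) = g a /\ H (s, b) = g b)].

Lemma smoothable_trans (g : R -> M) a b c : a <= b -> b <= c ->
  smoothable g a b -> smoothable g b c -> smoothable g a c.
Proof.
move=> ab bc [d1 [s1 [H1 [sd1 c1 e1 f1]]]] [d2 [s2 [H2 [sd2 c2 e2 f2]]]].
pose d t := if t <= b then d1 t else d2 t.
pose H x := if x.2 <= b then H1 x else H2 x.
have d12 : d1 b = d2 b.
  have [|_ <-] := e1 b; first by rewrite ab lexx.
  have [|_ <-] := e2 b; first by rewrite bc lexx.
  have i1 : 0 <= (1 : R) <= 1 by rewrite ler01 lexx.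
  by have [_ ->] := f1 1 i1; have [->] := f2 1 i1.
exists d, (s1 ++ s2), H; split.
- apply: (subdivision_cat (t1 := b)).
    by apply: subdivision_eq sd1 => t tab; rewrite /d ifT//; case/andP: tab.
  apply: subdivision_eq sd2 => t tbc; rewrite /d; case: ifPn => // tb.
  by have -> : t = b by [lra]; rewrite d12.
- rewrite -(rectU_v 0 1 ab bc); apply: withinU_continuous; try exact: closed_rect.
    apply: subspace_eq_continuous c1 => x; rewrite inE => /rectP[_ x2].
    by rewrite /from_subspace /H ifT//; case/andP: x2.
  apply: subspace_eq_continuous c2 => x; rewrite inE => /rectP[x1 x2].
  rewrite /from_subspace /H; case: ifPn => // xb.
  have -> : x = (x.1, b) by rewrite [LHS]surjective_pairing; congr pair; lra.
  by have [_ ->] := f1 _ x1; have [->] := f2 _ x1.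
- move=> t tac; rewrite /H /d /=; case: ifPn => tb; [apply: e1|apply: e2]; lra.
- move=> s s01; rewrite /H /= ab; have [-> f1b] := f1 _ s01; split=> //.
  by case: ifPn => cb; [have -> : c = b by [lra]|have [] := f2 _ s01].
Qed.

(** Over a short interval the path lies in the preimage of a coordinate ball, and by convexity it
    deforms linearly to the chord with the same endpoints. *)
Lemma smoothable_local (g : R -> M) (x : R) : {within `[0, 1], continuous g} ->
  0 <= x <= 1 -> exists2 e : R, 0 < e & forall a b : R, 0 <= a -> a <= b ->
    b <= 1 -> `|a - x| < e -> `|b - x| < e -> smoothable g a b.
Proof.
move=> gc x01.
have [Ach /(_ (g x))[c Ac cx] _] := hA.
have ch := Ach _ Ac.
have /nbhs_ballP[r /= r0 Hr] := near_cimg ch (cimg_cmap cx).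
have nB : \forall q \near g x, cdom c q /\ ball (cmap c (g x)) r (cmap c q).
  by apply: filterI; [exact: near_cdom|apply: near_cmap => //; exact: nbhsx_ballx].
have x01' : `[0, 1]%classic x by rewrite /= in_itv.
have /subspace_continuousP/(_ _ x01' _ nB) := gc.
rewrite nbhs_simpl /= => /near_withinP /nbhs_ballP[e /= e0 He].
exists e => // a b a0 ab b1 ax bx.
have inB t : a <= t <= b -> cdom c (g t) /\ ball (cmap c (g x)) r (cmap c (g t)).
  move=> tab; apply: He; last by rewrite /= in_itv/=; lra.
  by rewrite /ball/= ltr_distlC; move: ax bx; rewrite !ltr_distl; lra.
have g01 : {within `[a, b], continuous g}.
  by apply: continuous_subspaceW gc => t; rewrite /= !in_itv/=; lra.
have sndc : {within rect 0 1 a b, continuous (snd : R * R -> R)}.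
  by apply: continuous_subspaceT => y; exact: cvg_snd.
have gsc : {within rect 0 1 a b, continuous (g \o (snd : R * R -> R))}.
  by apply: (continuous_within_comp g01 sndc) => y [].
(* Arcs have positive length, so a degenerate interval gets the empty subdivision and the stationary
   homotopy. *)
have [eab|anb] := eqVneq a b.
  by exists g, [::], (g \o snd); split.
have {}ab : a < b by rewrite lt_neqAle anb.
pose za := cmap c (g a); pose zb := cmap c (g b).
pose u := (b - a)^-1 *: (zb - za).
(* The chord from [za] to [zb], written as a point plus t times a vector so that it is smooth on all
   of R. *)
pose l (t : R) := (za - a *: u) + t *: u.
have lE t : l t = (1 - (t - a) / (b - a)) *: za + ((t - a) / (b - a)) *: zb.
  rewrite /l -addrA -scaleNr -scalerDl [- a + t]addrC /u scalerA scalerBr.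
  by rewrite scalerBl scale1r addrA addrAC.
have la : l a = za by rewrite lE subrr mul0r subr0 scale1r scale0r addr0.
have lb : l b = zb by rewrite lE divff ?subr_eq0 ?gt_eqF// subrr scale0r add0r scale1r.
have [ca Bza] : cdom c (g a) /\ ball (cmap c (g x)) r za by apply: inB; rewrite lexx ltW.
have [cb Bzb] : cdom c (g b) /\ ball (cmap c (g x)) r zb by apply: inB; rewrite lexx ltW.
have lB t : a <= t <= b -> ball (cmap c (g x)) r (l t).
  move=> tab; rewrite lE; apply: ball_convex => //.
  by rewrite divr_ge0 ?ler_pdivrMr; lra.
pose K (y : R * R) := (1 - y.1) *: cmap c (g y.2) + y.1 *: l y.2.
have KB y : rect 0 1 a b y -> ball (cmap c (g x)) r (K y).
  move=> /rectP[y1 y2]; apply: ball_convex => //; last exact: lB.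
  by case: (inB _ y2).
have ciB z : ball (cmap c (g x)) r z -> cdom c (cinv c z) /\ cmap c (cinv c z) = z.
  by move=> /Hr; exact: cinv_cimg.
exists (cinv c \o l), [:: SmoothArc a b c l], (cinv c \o K); split.
- split=> //=; split=> //; first exact: smooth_on_line.
  by move=> t; rewrite in_itv/= => /lB /ciB.
- have cic : {within ball (cmap c (g x)) r, continuous (cinv c)}.
    apply: continuous_in_subspaceT => z; rewrite inE => /Hr; exact: cinv_continuous.
  apply: (continuous_within_comp cic _ KB).
  have cgc : {within rect 0 1 a b, continuous (fun y : R * R => cmap c (g y.2))}.
    have cc : {within cdom c, continuous (cmap c)} by case: ch.
    apply: (continuous_within_comp cc gsc) => y /rectP[_ /inB[]]; exact.
  have fc : {within rect 0 1 a b, continuous (fun y : R * R => y.1)}.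
    by apply: continuous_subspaceT => y; exact: cvg_fst.
  have lc : {within rect 0 1 a b, continuous (fun y : R * R => l y.2)}.
    apply: continuous_subspaceT => y; apply: cvgD; first exact: cvg_cst.
    by apply: cvgZr_tmp; exact: cvg_snd.
  move=> y; apply: cvgD; apply: cvgZ.
  + by apply: cvgB; [exact: cvg_cst|exact: fc].
  + exact: cgc.
  + exact: fc.
  + exact: lc.
- move=> t tab; rewrite /K /= subr0 scale1r scale0r addr0 subrr scale0r add0r scale1r.
  by rewrite cmapK//; case: (inB _ tab).
- move=> s s01; rewrite /K /= la lb -/za -/zb -!scalerDl subrK !scale1r.
  by rewrite !cmapK.
Qed.

Lemma loop_piecewise_smooth x (g : R -> M) : is_loop x g ->
  exists d s, [/\ is_loop x d, homotopic x g d & subdivision A d 0 s 1].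
Proof.
move=> [gc g0 g1].
have [d [s [H [sd Hc He Hf]]]] : smoothable g 0 1.
  apply: interval_induction.
    by move=> a b c _ ab bc _; exact: smoothable_trans.
  by move=> t t01; exact: smoothable_local.
have i0 : 0 <= (0 : R) <= 1 by rewrite lexx ler01.
have i1 : 0 <= (1 : R) <= 1 by rewrite lexx ler01.
exists d, s; split=> //.
- split.
  + have ic : {within `[0, 1], continuous (fun t : R => (1 : R, t))}.
      apply: continuous_subspaceT => t.
      by apply: pair_cvg; [exact: cvg_cst|exact: cvg_id].
    have : {within `[0, 1], continuous (H \o (fun t : R => (1 : R, t)))}.
      apply: (continuous_within_comp Hc ic) => t; rewrite /= in_itv/= => t01.
      exact/rectP.
    apply: subspace_eq_continuous => t; rewrite inE /= in_itv/= => t01.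
    by rewrite /from_subspace /=; case: (He _ t01).
  + by have [_ <-] := He _ i0; rewrite -g0; case: (Hf _ i1).
  + by have [_ <-] := He _ i1; rewrite -g1; case: (Hf _ i1).
- exists H; split; first exact: Hc.
  move=> t; rewrite in_itv/= => t01; have [? ?] := He _ t01.
  by have [h0 h1] := Hf _ t01; split=> //; rewrite ?h0 ?h1.
Qed.

End PiecewiseSmooth.

(** * Primitives on the covering *)

Section Concat.
Variable R : realType.

Lemma concat_continuous (T : topologicalType) (g1 g2 : R -> T) :
  continuous g1 -> continuous g2 -> g1 1 = g2 0 -> continuous (concat g1 g2).
Proof.
move=> c1 c2 g12; apply/continuous_subspace_setT.
have -> : [set: R] = `]-oo, 2^-1] `|` `[2^-1, +oo[.
  apply/seteqP; split => // t _; rewrite /= !in_itv/= andbT.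
  by case: (leP t 2^-1) => [|/ltW]; [left|right].
apply: withinU_continuous; try exact: interval_closed.
- have H : {within `]-oo, 2^-1], continuous (fun t : R => g1 (2 * t))}.
    apply: continuous_subspaceT => t; apply: continuous_comp; last exact: c1.
    by apply: cvgMr; exact: cvg_id.
  apply: subspace_eq_continuous H => t; rewrite inE /= in_itv/= => t2.
  by rewrite /from_subspace /concat t2.
- have H : {within `[2^-1, +oo[, continuous (fun t : R => g2 (2 * t - 1))}.
    apply: continuous_subspaceT => t; apply: continuous_comp; last exact: c2.
    by apply: cvgB; [apply: cvgMr; exact: cvg_id|exact: cvg_cst].
  apply: subspace_eq_continuous H => t; rewrite inE /= in_itv/= andbT => t2.
  rewrite /from_subspace /concat; case: ifPn => // t2'.
  have -> : t = 2^-1 by apply/eqP; rewrite eq_le t2 t2'.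
  by rewrite divff// subrr.
Qed.

Lemma concat0 (T : Type) (g1 g2 : R -> T) : concat g1 g2 0 = g1 0.
Proof. by rewrite /concat invr_ge0 ler0n mulr0. Qed.

Lemma concat1 (T : Type) (g1 g2 : R -> T) : concat g1 g2 1 = g2 1.
Proof. by rewrite /concat ifF; [congr g2; ring|apply/negbTE; lra]. Qed.

Variables (M : topologicalType) (F : Type).
Variable S : set M -> (M -> F) -> Prop.

Lemma lifts_concat (g1 g2 : R -> M) u : g1 1 = g2 0 ->
  lifts S (concat g1 g2) `[0, 1] u ->
  lifts S g1 `[0, 1] (fun t => u (t / 2)) /\
  lifts S g2 `[0, 1] (fun t => u ((1 + t) / 2)).
Proof.
move=> g12 lu.
have reparam (i : R -> R) (g : R -> M) : continuous i ->
    (forall t, 0 <= t <= 1 -> 0 <= i t <= 1 /\ concat g1 g2 (i t) = g t) ->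
    lifts S g `[0, 1] (u \o i).
  move=> ic ig; have ic' : {within `[0, 1], continuous i} by exact: continuous_subspaceT.
  apply: (eq_lifts (h1 := concat g1 g2 \o i)) (lifts_comp ic' _ lu).
  - by move=> t; rewrite inE /= in_itv/= => /ig[].
  - by [].
  - by move=> t; rewrite /= !in_itv/= => /ig[].
split; apply: reparam.
- by move=> t; apply: cvgMl; exact: cvg_id.
- move=> t t01; split; first lra.
  by rewrite /concat ifT; [congr g1; field|lra].
- by move=> t; apply: cvgMl; apply: cvgD; [exact: cvg_cst|exact: cvg_id].
- move=> t t01; split; first lra.
  rewrite /concat; case: ifPn => ht; last by congr g2; field.
  have -> : t = 0 by lra.
  by rewrite -g12; congr g1; field.
Qed.

End Concat.

(** * Path connectedness of the covering space *)

Section PathsInCovering.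
Variables (R : realType) (M N : topologicalType) (A : set (chart R M)).
Variable p : N -> M.
Hypotheses (hA : complex_atlas A) (hp : covering p).

(** Paths are taken continuous on all of R here; clamping the parameter makes a segment stationary
    outside [0, 1], so that it never leaves a ball containing its endpoints. *)
Definition clamp (t : R) : R := Num.max 0 (Num.min t 1).

Lemma clamp01 t : 0 <= clamp t <= 1.
Proof. by rewrite le_max lexx ge_max ler01 ge_min lexx orbT. Qed.

Lemma clamp_continuous : continuous clamp.
Proof.
move=> t.
apply: (continuous_max (f := cst 0 : R -> R^o) (g := (id : R -> R^o) \min cst 1)).
  exact: cvg_cst.
by apply: (continuous_min (f := id : R -> R^o)); [exact: cvg_id|exact: cvg_cst].
Qed.

Lemma covering_sheet y : exists U V s, [/\ open V, V y, is_section p U s,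
  (forall x, U x -> V (s x)) & forall z, V z -> U (p z) /\ s (p z) = z].
Proof.
have [_ pF] := hp; have [U [oU Ux [F [Ftriv FU FV]]]] := pF (p y).
have [V FW Vy] : exists2 V, F V & V y.
  have : (p @^-1` U) y by [].
  by rewrite -FU => -[V ? ?]; exists V.
have [oV /(sheet_section oU)[s [ss sU sV]]] := FV _ FW.
by exists U, V, s.
Qed.

Lemma open_chart_ball (c : chart R M) (B : set (R * R)) : is_chart c -> open B ->
  open (cdom c `&` cmap c @^-1` B).
Proof.
move=> [oD _ _ cc _] oB.
by move: cc; rewrite continuous_open_subspace// => /(continuous_inP _ oD); apply.
Qed.

(** [W] is the part of a sheet over a coordinate ball, and segments of the ball lift through the
    local section. [O] will be the domain of a primitive, over which the paths have to stay. *)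
Lemma local_paths y (O : set M) : open O -> O (p y) ->
  exists W, [/\ open W, W y, (forall z, W z -> O (p z)) &
    forall y1 y2, W y1 -> W y2 -> exists g : R -> N,
      [/\ continuous g, g 0 = y1, g 1 = y2 & forall t, W (g t)]].
Proof.
move=> oO Oy; have [pc _] := hp.
have [U [V [s [oV Vy [oU sU] sV Vs]]]] := covering_sheet y.
have [Ach /(_ (p y))[c Ac cy] _] := hA.
have ch := Ach _ Ac.
have Uy : U (p y) by case: (Vs _ Vy).
have nUO : \forall q \near p y, U q /\ O q.
  by apply: open_nbhs_nbhs; split; [exact: openI|split].
have : \forall z \near cmap c (p y), cimg c z /\ (U (cinv c z) /\ O (cinv c z)).
  by apply: filterI; [exact: near_cimg (cimg_cmap cy)|exact: near_cinv nUO].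
move=> /nbhs_ballP[r /= r0 Hr].
pose B := ball (cmap c (p y)) r.
exists (V `&` p @^-1` (cdom c `&` cmap c @^-1` B)); split.
- apply: openI => //; apply: open_comp; first by move=> z _; exact: pc.
  by apply: open_chart_ball => //; exact: ball_open.
- by split=> //; split=> //; exact: ballxx.
- move=> z [_ [cz /Hr[_ [_]]]]; by rewrite cmapK.
move=> y1 y2 [V1 [c1 B1]] [V2 [c2 B2]].
pose l (t : R) := (1 - clamp t) *: cmap c (p y1) + clamp t *: cmap c (p y2).
have lB t : B (l t) by apply: ball_convex => //; exact: clamp01.
have lc : continuous l.
  move=> t; apply: cvgD; apply: cvgZr_tmp; last exact: clamp_continuous.
  by apply: cvgB; [exact: cvg_cst|exact: clamp_continuous].
exists (s \o (cinv c \o l)); split.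
- move=> t; have [It [Ut _]] := Hr _ (lB t).
  apply: continuous_comp; last by case: (sU _ Ut).
  by apply: continuous_comp; [exact: lc|exact: cinv_continuous].
- rewrite /= /l /clamp min_l ?ler01// maxxx subr0 scale1r scale0r addr0 cmapK//.
  by case: (Vs _ V1).
- rewrite /= /l /clamp minxx max_r// subrr scale0r scale1r add0r cmapK//.
  by case: (Vs _ V2).
- move=> t; have [It [Ut _]] := Hr _ (lB t); split; first exact: sV.
  have [dt tE] := cinv_cimg ch It.
  by rewrite /preimage /= (sU _ Ut).2; split=> //=; rewrite tE; exact: lB.
Qed.

(** By [local_paths], being the end of a path from [y0] is a locally constant condition. *)
Lemma path_from y0 y : connected [set: N] ->
  exists g : R -> N, [/\ continuous g, g 0 = y0 & g 1 = y].
Proof.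
move=> cN.
pose E := [set y | exists g : R -> N, [/\ continuous g, g 0 = y0 & g 1 = y]].
suff : [set: N] `<=` E by apply.
apply: (connected_induction cN (x0 := y0)) => //.
  by exists (cst y0); split=> // t; exact: cvg_cst.
move=> z _; have [W [oW Wz _ Wpath]] := local_paths openT (I : setT (p z)).
apply/near_withinP.
have : \forall w \near z, W w by exact: open_nbhs_nbhs.
apply: filterS => w Ww _; split=> -[g [gc g0 g1]].
  have [s [sc s0 s1 _]] := Wpath _ _ Ww Wz.
  exists (concat g s); split; last by rewrite concat1.
    by apply: concat_continuous => //; rewrite g1.
  by rewrite concat0.
have [s [sc s0 s1 _]] := Wpath _ _ Wz Ww.
exists (concat g s); split; last by rewrite concat1.
  by apply: concat_continuous => //; rewrite g1.
by rewrite concat0.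
Qed.

End PathsInCovering.

(** * The primitive on the covering, and the case of vanishing periods *)

Section FormCovering.
Variables (R : realType) (M N : topologicalType) (A : set (chart R M)) (n : nat).
Variables (alpha : one_form R M 'rV[R]_n) (p : N -> M) (y0 : N).
Hypotheses (hA : complex_atlas A) (ha : real_form A alpha)
  (hs : smooth_form A alpha) (hc : closed_form A alpha).
Hypothesis hp : covering_of_form A alpha (p y0) p y0.

Let prim := is_primitive A alpha.
Let primS := primitive_system hA ha hs hc.
Let pcov : covering p. Proof. by case: hp. Qed.
Let pc : continuous p. Proof. by case: pcov. Qed.

(** [v] is the integral of the pulled back form along some path from [y0] to [y], expressed through
    the lift with initial value 0. *)
Let reaches (y : N) (v : 'rV[R]_n) := exists (g : R -> N) u,
  [/\ continuous g, g 0 = y0, g 1 = y, lifts prim (p \o g) `[0, 1] u &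
      u 0 = 0 /\ u 1 = v].

Let pgc (g : R -> N) : continuous g -> {within `[0, 1], continuous (p \o g)}.
Proof.
move=> gc; apply: continuous_subspaceT => t.
by apply: continuous_comp; [exact: gc|exact: pc].
Qed.

Let reaches_total y : exists v, reaches y v.
Proof.
have [_ cN _ _] := hp.
have [g [gc g0 g1]] := path_from hA pcov y0 y cN.
have [u ul u0] := lift_path primS (v := 0) (pgc gc) I.
by exists (u 1), g, u.
Qed.

(** Out along one path and back along the other is a loop of [N]. Its projection lies in the image
    of pi_1(N), hence is homotopic to a loop with zero integral, along which every lift closes
    up. *)
Let reaches_unique y v w : reaches y v -> reaches y w -> v = w.
Proof.
move=> [g1 [u1 [c1 g10 g11 l1 [u10 <-]]]] [g2 [u2 [c2 g20 g21 l2 [u20 <-]]]].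
have [_ _ _ kerE] := hp.
pose d := concat g1 (fun t => g2 (1 - t)).
have dc : continuous d.
  apply: concat_continuous => //; last by rewrite subr0 g11.
  move=> t; apply: continuous_comp; last exact: c2.
  by apply: cvgB; [exact: cvg_cst|exact: cvg_id].
have d0 : d 0 = y0 by rewrite /d concat0.
have d1 : d 1 = y0 by rewrite /d concat1 subrr.
have pd : is_loop (p y0) (p \o d).
  by split; [exact: pgc|rewrite /= d0|rewrite /= d1].
have : pi1_image p y0 (p \o d).
  split=> //; exists d; split; first by split=> //; exact: continuous_subspaceT.
  exists (p \o d \o (snd : R * R -> R)); split.
    apply: continuous_subspaceT => x; apply: continuous_comp; first exact: cvg_snd.
    by apply: continuous_comp; [exact: dc|exact: pc].
  by move=> t _; split=> //=; rewrite ?d0 ?d1.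
rewrite kerE => -[_ [e [[ec e0 e1] hom [s sub I0]]]].
have pdE : p \o d = concat (p \o g1) (fun t => (p \o g2) (1 - t)).
  by apply/funext => t; rewrite /d /concat /=; case: ifP.
rewrite pdE in hom.
apply: (monodromy primS hom (pgc c1) (pgc c2) _ l1 l2).
- by rewrite /= g11 g21.
- by rewrite u10 u20.
- move=> u ul <-; have := sub_integral_lift hA ha hs sub ul.
  by rewrite -I0 => /esym/eqP; rewrite subr_eq0 => /eqP.
Qed.

(** Prolong the path by a short one lying over [U]: along it the lift is [f] plus the constant that
    matches [v] at [y]. *)
Let reaches_near y v U f : reaches y v -> prim U f -> U (p y) ->
  \forall z \near y, reaches z (f (p z) + (v - f (p y))).
Proof.
move=> [g [u [gc g0 g1 ul [u0 u1]]]] fp Uy.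
have oU : open U by case: fp.
have [W [oW Wy WU Wpath]] := local_paths hA pcov oU Uy.
have : \forall z \near y, W z by exact: open_nbhs_nbhs.
apply: filterS => z Wz.
have [s [sc s0 s1 sW]] := Wpath _ _ Wy Wz.
have gs : g 1 = s 0 by rewrite g1.
have cc := concat_continuous gc sc gs.
have [w wl w0] := lift_path primS (v := 0) (pgc cc) I.
exists (concat g s), w; rewrite concat0 concat1; split=> //; split=> //.
have pgsE : p \o concat g s = concat (p \o g) (p \o s).
  by apply/funext => t; rewrite /concat /=; case: ifP.
rewrite pgsE in wl.
have pgs : (p \o g) 1 = (p \o s) 0 by rewrite /= gs.
have [wl1 wl2] := lifts_concat pgs wl.
have in0 : `[0, 1]%classic (0 : R) by rewrite /= in_itv/= lexx ler01.
have in1 : (1 : R) \in `[0, 1]%classic by rewrite inE /= in_itv/= lexx ler01.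
have seg := @segment_connected R 0 1.
have w2 : w 2^-1 = v.
  have := lifts_unique primS seg (pgc gc) wl1 ul in0.
  by rewrite /= mul0r w0 u0 => /(_ erefl 1 in1); rewrite mul1r u1.
have fl : lifts prim (p \o s) `[0, 1] (fun t => f (p (s t)) + (v - f (p y))).
  move=> t _; exists U, (fun x => f x + (v - f (p y))); split.
  - exact: primitiveD_cst.
  - exact: WU.
  - exact: nearW.
have := lifts_unique primS seg (pgc sc) wl2 fl in0.
rewrite addr0 mul1r w2 s0 addrC subrK => /(_ erefl 1 in1).
by rewrite s1 [in X in X -> _]divff.
Qed.

(** The primitive of the pulled back form is obtained as a lift of the map [p] itself, which
    requires no charts on [N]. *)
Lemma primitive_on_covering : exists phi : N -> 'rV[R]_n,
  lifts (is_primitive A alpha) p setT phi.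
Proof.
have [phi Hphi] := choice reaches_total.
exists phi => y _; have [U Uy [f fp]] := primitive_exists hA ha hs hc (p y).
exists U, (fun x => f x + (phi y - f (p y))).
split; [exact: primitiveD_cst|exact: Uy|].
apply/near_withinP; have := reaches_near (Hphi y) fp Uy.
by apply: filterS => z Hz _; exact: reaches_unique Hz.
Qed.

Hypothesis hM : connected [set: M].
Hypothesis periods0 : forall (gamma : R -> M) s, gamma 0 = gamma 1 ->
  subdivision A gamma 0 s 1 -> sub_integral alpha gamma s = 0.

(** An evenly covered set with one point in the image lies in the image, since a whole sheet lies
    over it. *)
Let surjective x : exists y, p y = x.
Proof.
suff : [set: M] `<=` [set x | exists y, p y = x] by apply.
apply: (connected_induction hM (x0 := p y0)) => //; first by exists y0.
move=> z _; have [_ /(_ z)[U [oU Uz [F [_ FU FV]]]]] := pcov.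
apply/near_withinP; have : \forall w \near z, U w by exact: open_nbhs_nbhs.
have mv a b : U a -> U b -> (exists y, p y = a) -> exists y, p y = b.
  move=> Ua Ub [y pya].
  have [V FW Vy] : exists2 V, F V & V y.
    have : (p @^-1` U) y by rewrite /preimage /= pya.
    by rewrite -FU => -[V ? ?]; exists V.
  have [_ [s [sV _ _]]] := FV _ FW.
  by exists (s b); case: (sV _ Ub).
by apply: filterS => w Uw _; split; exact: mv.
Qed.

(** Paths to two points of one fibre project to a loop of [M]. Vanishing periods place it in the
    period kernel, hence in the image of pi_1(N): it is homotopic to the projection of a loop [e].
    Every lift of that projection from [y0] is [e] itself and closes up, so [monodromy] identifies
    the two points. *)
Let p_inj : injective p.
Proof.
move=> y1 y2 y12.
have [_ cN _ kerE] := hp.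
have [g1 [c1 g10 g11]] := path_from hA pcov y0 y1 cN.
have [g2 [c2 g20 g21]] := path_from hA pcov y0 y2 cN.
have g12 : (p \o g1) 1 = (p \o g2) 1 by rewrite /= g11 g21.
pose d := concat (p \o g1) (fun t => (p \o g2) (1 - t)).
have dc : continuous d.
  apply: concat_continuous; last by rewrite subr0.
    by move=> t; apply: continuous_comp; [exact: c1|exact: pc].
  move=> t; apply: (@continuous_comp _ _ _ (fun t : R => 1 - t) (p \o g2)).
    by apply: cvgB; [exact: cvg_cst|exact: cvg_id].
  by apply: continuous_comp; [exact: c2|exact: pc].
have dl : is_loop (p y0) d.
  split; first exact: continuous_subspaceT.
    by rewrite /d concat0 /= g10.
  by rewrite /d concat1 subrr /= g20.
have : period_kernel A alpha (p y0) d.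
  split=> //; have [e [s [el hom sub]]] := loop_piecewise_smooth hA dl.
  exists e; split=> //; exists s => //.
  by rewrite periods0//; case: el => _ -> ->.
rewrite -kerE => -[_ [e [[ec e0 e1] hom]]].
have covS := covering_system pcov.
rewrite -g11 -g21; apply: (monodromy covS hom (pgc c1) (pgc c2) g12).
- by apply: (continuous_lifts pcov); exact: continuous_subspaceT.
- by apply: (continuous_lifts pcov); exact: continuous_subspaceT.
- by rewrite g10 g20.
- move=> u ul; rewrite g10 => u0.
  have pec : {within `[0, 1], continuous (p \o e)}.
    apply: (continuous_within_comp (D := setT) _ ec) => //.
    exact: continuous_subspaceT.
  have el := continuous_lifts pcov ec.
  have in0 : `[0, 1]%classic (0 : R) by rewrite /= in_itv/= lexx ler01.
  have in1 : (1 : R) \in `[0, 1]%classic by rewrite inE /= in_itv/= lexx ler01.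
  have seg := @segment_connected R 0 1.
  by rewrite (lifts_unique covS seg pec ul el in0 _ in1) ?u0 ?e0.
Qed.

Lemma covering_homeomorphism : is_homeomorphism p.
Proof.
split; first exact: pc.
have [s sE] := choice surjective.
exists s; split=> //; last by move=> y; apply: p_inj; rewrite sE.
move=> x; have [U [V [r [oV Vx [oU rU] _ Vr]]]] := covering_sheet pcov (s x).
have Ux : U x by rewrite -(sE x); case: (Vr _ Vx).
(* By injectivity of [p], the inverse agrees near [x] with a continuous local section. *)
have rs : \forall z \near x, r z = s z.
  have : \forall z \near x, U z by exact: open_nbhs_nbhs.
  by apply: filterS => z Uz; apply: p_inj; rewrite sE (rU _ Uz).2.
have := (rU _ Ux).1; rewrite /prop_for /continuous_at (nbhs_singleton rs).
by apply: cvg_trans; apply: near_eq_cvg.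
Qed.

End FormCovering.

(** * Conformal immersions *)

Section CkOn.
Variables (R : realType) (V W : normedModType R).

Lemma Ck_on_eq k (U : set V) (f g : V -> W) : open U ->
  (forall x, U x -> f x = g x) -> Ck_on k U f -> Ck_on k U g.
Proof.
move=> oU; elim: k f g => [|k IH] f g fg.
  move=> fc x Ux; have := fc _ Ux; rewrite /prop_for /continuous_at fg//.
  apply: cvg_trans; apply: near_eq_cvg.
  have : \forall y \near x, U y by exact: open_nbhs_nbhs.
  by apply: filterS => y /fg.
have fgn x : U x -> \forall y \near x, f y = g y.
  move=> Ux; have : \forall y \near x, U y by exact: open_nbhs_nbhs.
  by apply: filterS => y /fg.
move=> [fd fk]; split.
  by move=> x Ux; have [] := near_eq_is_diff (fgn _ Ux) (differentiableP (fd _ Ux)).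
move=> v; apply: IH (fk v) => x Ux.
exact: near_eq_derive (fgn _ Ux).
Qed.

Lemma Ck_on_subset k (U U' : set V) (f : V -> W) : U' `<=` U ->
  Ck_on k U f -> Ck_on k U' f.
Proof.
move=> UU'; elim: k f => [|k IH] f; first by move=> fc x /UU'/fc.
by move=> [fd fk]; split=> [x /UU'/fd|v]; [exact|exact: IH (fk v)].
Qed.

(** As [Ck_on] differentiates along fixed directions, the differential need only be smooth in the
    base point. *)
Lemma smooth_on_differential (U : set V) (f : V -> W) (df : V -> V -> W) :
  open U -> (forall x, U x -> is_diff x f (df x)) ->
  (forall v, smooth_on U (df ^~ v)) -> smooth_on U f.
Proof.
move=> oU fd dfs [|k].
  by move=> x Ux; have [/differentiable_continuous] := fd _ Ux.
split=> [x Ux|v]; first by have [] := fd _ Ux.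
apply: Ck_on_eq (dfs v k) => // x Ux; have [dx dxE] := fd _ Ux.
by rewrite (deriveE _ dx) dxE.
Qed.

End CkOn.

Section DotProduct.
Variables (R : realType) (n : nat).
Implicit Types a b : 'rV[R]_n.

Lemma dotr_comb a b (x y x' y' : R) :
  dotr (x *: a + y *: b) (x' *: a + y' *: b) =
  x * x' * dotr a a + y * y' * dotr b b + (x * y' + y * x') * dotr a b.
Proof.
rewrite /dotr !mulr_sumr -!big_split; apply: eq_bigr => j _ /=.
rewrite !mxE; ring.
Qed.

Lemma dotr_ge0 a : 0 <= dotr a a.
Proof. by apply: sumr_ge0 => j _; rewrite -expr2 sqr_ge0. Qed.

Lemma dotr_eq0 a : dotr a a = 0 -> a = 0.
Proof.
move=> /eqP; rewrite psumr_eq0; last by move=> j _; rewrite -expr2 sqr_ge0.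
move=> /allP a0; apply/rowP => j; rewrite mxE.
have := a0 j (mem_index_enum _); rewrite /= mulf_eq0 orbb; exact: eqP.
Qed.

End DotProduct.

(** * Algebra of Weierstrass representations at a point *)

Section Weierstrass.
Variables (R : realType) (M : topologicalType) (A : set (chart R M)).
Variable omega : one_form R M 'rV[R[i]]_3.
Hypothesis hW : weierstrass_representation A omega.

Lemma real_form_re : real_form A (re_form omega).
Proof.
have [[lin tr] _ _ _ _] := hW; split.
  move=> c q Ac cq a u v; rewrite /re_form lin//.
  apply/rowP => j; rewrite !mxE; case: (omega c q u 0 j) => x y.
  by case: (omega c q v 0 j) => x' y' /=; rewrite mul0r subr0.
by move=> c d q Ac Ad cq dq v; rewrite /re_form -tr.
Qed.

Lemma re_formJ c q v : A c -> cdom c q ->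
  re_form omega c q (cJ v) = - im_form omega c q v.
Proof.
move=> Ac cq; have [_ _ J _ _] := hW.
apply/rowP => j; rewrite !mxE J// mxE; case: (omega c q v 0 j) => x y /=.
by rewrite mul0r mul1r sub0r.
Qed.

(** If omega(1, 0) = a + i b, then omega(0, 1) = - b + i a, so the two real vectors a and b
    determine the real part. *)
Lemma re_form_comb c q v : A c -> cdom c q ->
  re_form omega c q v =
  v.1 *: re_form omega c q (1, 0) + (- v.2) *: im_form omega c q (1, 0).
Proof.
move=> Ac cq; rewrite (formE real_form_re v Ac cq).
have -> : (0, 1) = cJ (1, 0) :> R * R by rewrite /cJ /= oppr0.
by rewrite re_formJ// scalerN scaleNr.
Qed.

(** With omega(1, 0) = a + i b, the sum of the squares is |a|^2 - |b|^2 + 2 i a.b, which vanishes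
    exactly when a and b are orthogonal of equal length. The factor is |a|^2; if it were 0, omega
    would vanish at the point. *)
Lemma re_form_conformal c q : A c -> cdom c q -> exists2 lambda : R, 0 < lambda &
  forall v w : R * R, dotr (re_form omega c q v) (re_form omega c q w) =
    lambda * (v.1 * w.1 + v.2 * w.2).
Proof.
move=> Ac cq; have [_ _ J nz iso] := hW.
set a := re_form omega c q (1, 0); set b := im_form omega c q (1, 0).
have [abE ab0] : dotr a a = dotr b b /\ dotr a b = 0.
  have := iso _ _ Ac cq (1, 0).
  have -> : \sum_(j < 3) omega c q (1, 0) 0 j ^+ 2 =
      ((dotr a a - dotr b b) +i* (dotr a b *+ 2))%C.
    rewrite /dotr -sumrB -sumrMnl.
    rewrite [RHS](_ : _ = \sum_(j < 3)
        ((a 0 j * a 0 j - b 0 j * b 0 j) +i* (a 0 j * b 0 j *+ 2))%C).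
      apply: eq_bigr => j _; rewrite /a /b !mxE; case: (omega c q (1, 0) 0 j) => x y /=.
      by rewrite expr2; apply/eqP; rewrite eq_complex /= eqxx /= mulr2n [y * x]mulrC.
    by apply/eqP; rewrite eq_complex !raddf_sum /= !eqxx.
  move=> /eqP; rewrite eq_complex /= subr_eq0 => /andP[/eqP -> ].
  by rewrite mulrn_eq0 /= => /eqP.
exists (dotr a a).
  rewrite lt_neqAle dotr_ge0 andbT eq_sym; apply/eqP => aa0.
  have a0 := dotr_eq0 aa0; have b0 : b = 0 by apply: dotr_eq0; rewrite -abE.
  have rv0 v : re_form omega c q v = 0.
    by rewrite re_form_comb// -/a -/b a0 b0 !scaler0 addr0.
  have [v /eqP[]] := nz _ _ Ac cq; apply/rowP => j; rewrite mxE.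
  have /rowP/(_ j) := rv0 v; have /rowP/(_ j) := rv0 (cJ v); rewrite re_formJ// !mxE.
  case: (omega c q v 0 j) => x y /= /eqP; rewrite oppr_eq0 => /eqP -> ->.
  by [].
move=> v w; rewrite (re_form_comb v Ac cq) (re_form_comb w Ac cq) -/a -/b.
rewrite dotr_comb -abE ab0; ring.
Qed.

(** Since Re omega(I v) = - Im omega(v), subtracting i d phi(I v) restores the imaginary part. The
    points [y] and [q] may lie on different surfaces, so that the lemma serves the covering as well
    as [M]. *)
Lemma weierstrass_of_re (N : topologicalType) (phi : N -> 'rV[R]_3) d y c q v :
  A c -> cdom c q -> (forall v, dmap phi d y v = re_form omega c q v) ->
  weierstrass_of phi d y v = omega c q v.
Proof.
move=> Ac cq dE; rewrite /weierstrass_of !dE re_formJ//.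
apply/rowP => j; rewrite !mxE; case: (omega c q v 0 j) => x y' /=.
by apply/eqP; rewrite eq_complex /=; apply/andP; split; apply/eqP; ring.
Qed.

Lemma re_weierstrass_of (N : topologicalType) (phi : N -> 'rV[R]_3)
    (d : chart R N) y v :
  map_mx (@complex.Re R) (weierstrass_of phi d y v) = dmap phi d y v.
Proof.
apply/rowP => j; rewrite !mxE /=; ring.
Qed.

End Weierstrass.

(** * Immersions of the covering *)

Section PullbackCharts.
Variables (R : realType) (M N : topologicalType) (A : set (chart R M)).
Variable p : N -> M.
Hypotheses (hA : complex_atlas A) (pc : continuous p).

(** Read in a chart and its lift, [p] is the identity. *)
Lemma cinv_pullback (d : chart R N) c y : is_chart c -> is_chart d ->
  (forall y, cdom d y -> cdom c (p y) /\ cmap d y = cmap c (p y)) ->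
  cdom d y -> \forall z \near cmap d y, p (cinv d z) = cinv c z.
Proof.
move=> ch dh cd dy; have := near_cimg dh (cimg_cmap dy).
apply: filterS => z Iz; have [dz dzE] := cinv_cimg dh Iz.
by have [cz czE] := cd _ dz; rewrite -[in RHS]dzE czE cmapK.
Qed.

Lemma pullback_chart_diff (c c' : chart R M) (d : chart R N) y :
  A c -> A c' -> is_chart d ->
  (forall y, cdom d y -> cdom c (p y) /\ cmap d y = cmap c (p y)) ->
  cdom d y -> cdom c' (p y) ->
  forall v, 'd (cmap c' \o p \o cinv d) (cmap d y) v =
            'd (cmap c' \o cinv c) (cmap c (p y)) v.
Proof.
move=> Ac Ac' dh cd dy cy' v; have [Ach _ hol] := hA.
have ch := Ach _ Ac; have [cy cyE] := cd _ dy.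
have holq : differentiable (cmap c' \o cinv c) (cmap c (p y)).
  by have [] := hol c c' Ac Ac' (cmap c (p y)); first by exists (p y).
rewrite -cyE in holq *.
have nE : \forall z \near cmap d y,
    (cmap c' \o cinv c) z = (cmap c' \o p \o cinv d) z.
  have := cinv_pullback ch dh cd dy.
  by apply: filterS => z /= ->.
have [_ E] := near_eq_is_diff nE (differentiableP holq).
exact: (congr1 (fun h => h v) E).
Qed.

(** A chart of [M] is transported to a sheet by the local section; its image shrinks to the part of
    [cimg c] that lies over the evenly covered set. *)
Lemma pullback_chart_exists y : covering p ->
  exists2 d, pullback_atlas p A d & cdom d y.
Proof.
move=> hp; have [U [V [s [oV Vy [oU sU] sV Vs]]]] := covering_sheet hp y.
have [Ach /(_ (p y))[c Ac cy] _] := hA; have ch := Ach _ Ac.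
have [oD oI cK cc ci] := ch.
exists (Chart (V `&` p @^-1` cdom c) (cmap c \o p) (s \o cinv c)); last by split.
split; last by exists c => // z [_ cz].
have imgE : cimg (Chart (V `&` p @^-1` cdom c) (cmap c \o p) (s \o cinv c)) =
    cimg c `&` cinv c @^-1` U.
  apply/seteqP; split=> [_ [z [Vz cz] <-]|z [Iz Uz]] /=.
    split; first by exists (p z).
    by rewrite /preimage /= cK//; case: (Vs _ Vz).
  have [cz czE] := cinv_cimg ch Iz.
  exists (s (cinv c z)); rewrite /preimage /= ?(sU _ Uz).2//.
  by split; [exact: sV|].
split.
- by apply: openI => //; apply: open_comp => // z _; exact: pc.
- rewrite imgE; move: ci; rewrite continuous_open_subspace//.
  by move=> /(continuous_inP _ oI); exact.
- by move=> z [Vz cz] /=; rewrite cK//; case: (Vs _ Vz).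
- have ppc : {within V `&` p @^-1` cdom c, continuous p} by exact: continuous_subspaceT.
  by apply: (continuous_within_comp cc ppc) => z [].
- rewrite imgE.
  have sc : {within U, continuous s}.
    by apply: continuous_in_subspaceT => z; rewrite inE => /sU[].
  have cic : {within cimg c `&` cinv c @^-1` U, continuous (cinv c)}.
    by apply: continuous_subspaceW ci; exact: subIsetl.
  by apply: (continuous_within_comp sc cic) => z [].
Qed.

Variable omega : one_form R M 'rV[R[i]]_3.
Hypothesis hW : weierstrass_representation A omega.
Let alpha := re_form omega.

Section LiftImmersion.
Variable phi : N -> 'rV[R]_3.
Hypothesis hphi : lifts (is_primitive A alpha) p setT phi.

Lemma lift_is_diff (d : chart R N) c y : A c -> is_chart d ->
  (forall y, cdom d y -> cdom c (p y) /\ cmap d y = cmap c (p y)) ->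
  cdom d y -> is_diff (cmap d y) (phi \o cinv d) (alpha c (p y)).
Proof.
move=> Ac dh cd dy; have [Ach _ _] := hA; have ch := Ach _ Ac.
have [U [f [[oU fp] Uy /near_withinP fE]]] := hphi (I : setT y).
have [cy cyE] := cd _ dy.
have fd := fp _ _ Ac Uy cy; rewrite -cyE in fd.
apply: near_eq_is_diff fd.
have nE : \forall z \near cmap d y, phi (cinv d z) = f (p (cinv d z)).
  apply: (near_cinv (P := fun z => phi z = f (p z)) dh dy).
  by apply: filterS fE => z; apply.
move: nE (cinv_pullback ch dh cd dy); apply: filterS2 => z /= -> ->.
by [].
Qed.

Lemma lift_dmap (d : chart R N) c y v : A c -> is_chart d ->
  (forall y, cdom d y -> cdom c (p y) /\ cmap d y = cmap c (p y)) ->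
  cdom d y -> dmap phi d y v = alpha c (p y) v.
Proof.
move=> Ac dh cd dy; have [_ dE] := lift_is_diff Ac dh cd dy.
exact: (congr1 (fun h => h v) dE).
Qed.

Lemma lift_conformal_immersion : conformal_immersion (pullback_atlas p A) phi.
Proof.
have [_ [sr si] _ _ _] := hW.
have conf d y : pullback_atlas p A d -> cdom d y -> exists2 lambda : R, 0 < lambda &
    forall v w : R * R, dotr (dmap phi d y v) (dmap phi d y w) =
      lambda * (v.1 * w.1 + v.2 * w.2).
  move=> [dh [c Ac cd]] dy; have [cy _] := cd _ dy.
  have [l l0 lE] := re_form_conformal hW Ac cy; exists l => // v w.
  by rewrite !(lift_dmap _ Ac dh cd dy).
split; last exact: conf.
- move=> d [dh [c Ac cd]].
  have [Ach _ _] := hA; have ch := Ach _ Ac.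
  have oI : open (cimg d) by case: dh.
  apply: (smooth_on_differential (df := fun z => alpha c (cinv c z))) => //.
    move=> z Iz; have [dz dzE] := cinv_cimg dh Iz.
    have [cz czE] := cd _ dz.
    have := lift_is_diff Ac dh cd dz; rewrite dzE.
    by have -> : p (cinv d z) = cinv c z by rewrite -[in RHS]dzE czE cmapK.
  move=> v k; apply: Ck_on_subset (sr _ Ac v k) => _ [y dy <-].
  by have [cy ->] := cd _ dy; exact: cimg_cmap.
- move=> d y dA dy v w vw; have [l l0 lE] := conf _ _ dA dy.
  have [dh [c Ac cd]] := dA; have [cy _] := cd _ dy.
  have [lin _] := real_form_re hW.
  (* Injectivity comes from conformality: the difference of two vectors with the same image is sent
     to 0, so its squared length times a positive factor is 0. *)
  have : dmap phi d y ((-1) *: w + v) = 0.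
    have aE u := lift_dmap u Ac dh cd dy.
    rewrite aE; apply: etrans (lin _ _ Ac cy (-1) w v) _.
    by move: vw; rewrite !aE /alpha => ->; rewrite scaleN1r addNr.
  move=> d0; have := lE (-1 *: w + v) (-1 *: w + v); rewrite d0.
  have -> : dotr (0 : 'rV[R]_3) 0 = 0.
    by rewrite /dotr big1// => j _; rewrite mxE mul0r.
  move=> /esym/eqP; rewrite mulf_eq0 gt_eqF//= paddr_eq0 ?sqr_ge0 -?expr2 ?sqr_ge0//.
  rewrite !sqrf_eq0 /= => /andP[/eqP h1 /eqP h2].
  move: v w h1 h2 {vw d0} => [v1 v2] [w1 w2] /=.
  rewrite ![-1 *: _]mulN1r ![- _ + _]addrC => /eqP + /eqP.
  by rewrite !subr_eq0 => /eqP-> /eqP->.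
Qed.

Lemma lift_is_pullback :
  is_pullback A (pullback_atlas p A) p omega (weierstrass_of phi).
Proof.
move=> c' d y Ac' [dh [c Ac cd]] dy cy' v; have [cy cyE] := cd _ dy.
rewrite (pullback_chart_diff Ac Ac' dh cd dy cy').
have [[_ tr] _ _ _ _] := hW; rewrite -(tr _ _ _ Ac Ac' cy cy').
by apply: (weierstrass_of_re hW v Ac cy) => w; exact: lift_dmap.
Qed.

End LiftImmersion.

(** The real part of the Weierstrass form is the differential of the map, so the two immersions have
    the same differential and their difference is locally constant. *)
Lemma pullback_immersion_unique (phi psi : N -> 'rV[R]_3) : covering p ->
  connected [set: N] -> inhabited N ->
  conformal_immersion (pullback_atlas p A) phi ->
  is_pullback A (pullback_atlas p A) p omega (weierstrass_of phi) ->
  conformal_immersion (pullback_atlas p A) psi ->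
  is_pullback A (pullback_atlas p A) p omega (weierstrass_of psi) ->
  exists b, forall y, psi y = phi y + b.
Proof.
move=> hp cN [y0] [sphi _ _] pphi [spsi _ _] ppsi.
suff H : [set: N] `<=` [set y | psi y - phi y = psi y0 - phi y0].
  exists (psi y0 - phi y0) => y; have /= <- := H y I.
  by rewrite addrC subrK.
apply: (connected_induction cN (x0 := y0)) => // y _.
have [d dA dy] := pullback_chart_exists y hp.
have [dh [c Ac cd]] := dA.
have /nbhs_ballP[r /= r0 Hr] := near_cimg dh (cimg_cmap dy).
have dz z : ball (cmap d y) r z -> is_diff z ((psi \o cinv d) - (phi \o cinv d)) 0.
  move=> /Hr Iz; have [dz dzE] := cinv_cimg dh Iz.
  have [cz _] := cd _ dz.
  have [/(_ _ Iz) dphi _] := sphi _ dA 1%N.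
  have [/(_ _ Iz) dpsi _] := spsi _ dA 1%N.
  have := is_diffB (differentiableP dpsi) (differentiableP dphi).
  congr (is_diff_def _ _ _); apply/funext => v.
  have E1 := re_weierstrass_of psi d (cinv d z) v.
  have E2 := re_weierstrass_of phi d (cinv d z) v.
  rewrite (ppsi _ _ _ Ac dA dz cz) in E1.
  rewrite (pphi _ _ _ Ac dA dz cz) in E2.
  rewrite /dmap dzE in E1 E2.
  have E : 'd (psi \o cinv d) z v = 'd (phi \o cinv d) z v := etrans (esym E1) E2.
  exact: etrans (congr1 (fun w => w - _) E) (subrr _).
have dconst := zero_diff_constant_row dz.
have nB : \forall w \near y, ball (cmap d y) r (cmap d w).
  by apply: near_cmap => //; exact: nbhsx_ballx.
apply/near_withinP; move: nB (near_cdom dh dy).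
apply: filterS2 => w /dconst + dw _; rewrite /= !fctE /=.
rewrite !(cmapK dh)// => ->.
by split.
Qed.

End PullbackCharts.

(** * Periods, and immersions of the surface itself *)

Section Periods.
Variables (R : realType) (M : topologicalType) (A : set (chart R M)).
Variable omega : one_form R M 'rV[R[i]]_3.
Hypothesis hA : complex_atlas A.
Hypothesis hW : weierstrass_representation A omega.

Let ha := real_form_re hW.
Let hs : smooth_form A (re_form omega). Proof. by case: hW => _ []. Qed.

Lemma primitive_periods (psi : M -> 'rV[R]_3) :
  is_primitive A (re_form omega) setT psi ->
  forall I, is_period A omega I -> purely_imaginary I.
Proof.
move=> ppsi _ [gamma g01 [s sub ->]].
have gl : lifts (is_primitive A (re_form omega)) gamma `[0, 1] (psi \o gamma).
  by move=> t _; exists setT, psi; split; [exact: ppsi|exact: I|exact: nearW].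
rewrite (sub_integral_lift hA ha hs sub gl) /= g01 subrr.
exists (sub_integral (im_form omega) gamma s).
by rewrite (_ : map_mx _ 0 = 0) ?add0r//; apply/rowP => j; rewrite !mxE.
Qed.

Lemma imaginary_periods (gamma : R -> M) s :
  (forall I, is_period A omega I -> purely_imaginary I) ->
  gamma 0 = gamma 1 -> subdivision A gamma 0 s 1 ->
  sub_integral (re_form omega) gamma s = 0.
Proof.
move=> im g01 sub.
have [|y yE] := im (map_mx (real_complex R) (sub_integral (re_form omega) gamma s) +
    'i%C *: map_mx (real_complex R) (sub_integral (im_form omega) gamma s)).
  by exists gamma => //; exists s.
apply/rowP => j; move/rowP/(_ j)/(congr1 (@complex.Re R)): yE.
by rewrite !mxE /= !mul0r !mul1r !subr0 !addr0.
Qed.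

Lemma immersion_primitive (phi : M -> 'rV[R]_3) : conformal_immersion A phi ->
  form_eq A (weierstrass_of phi) omega ->
  is_primitive A (re_form omega) setT phi.
Proof.
move=> [sphi _ _] feq; split; first exact: openT.
move=> c q Ac _ cq.
have [/(_ _ (cimg_cmap cq)) dphi _] := sphi _ Ac 1%N.
have := differentiableP dphi; congr (is_diff_def _ _ _); apply/funext => v.
have := re_weierstrass_of phi c q v; rewrite (feq _ _ Ac cq).
by move=> /esym.
Qed.

(** The identity of [M] takes the part of the covering map: every chart of [A] belongs to the atlas
    pulled back along [id]. *)
Lemma primitive_immersion (psi : M -> 'rV[R]_3) :
  lifts (is_primitive A (re_form omega)) id setT psi ->
  conformal_immersion A psi /\ form_eq A (weierstrass_of psi) omega.
Proof.
move=> lpsi; have [Ach _ _] := hA.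
have Aid c : A c -> pullback_atlas id A c.
  by move=> Ac; split; [exact: Ach|exists c].
have [c1 c2 c3] := lift_conformal_immersion hA hW lpsi.
split.
  by split=> [c /Aid/c1|c q /Aid/c2|c q /Aid/c3]; exact.
move=> c q Ac cq v.
apply: (weierstrass_of_re hW v Ac cq) => w.
exact: (lift_dmap hA lpsi w Ac (Ach _ Ac) (fun y cy => conj cy erefl) cq).
Qed.

Lemma lift_id_primitive (psi : M -> 'rV[R]_3) :
  lifts (is_primitive A (re_form omega)) id setT psi ->
  is_primitive A (re_form omega) setT psi.
Proof.
move=> lpsi; split; first exact: openT.
move=> c q Ac _ cq; have [Ach _ _] := hA.
exact: (lift_is_diff hA lpsi Ac (Ach _ Ac) (fun y cy => conj cy erefl) cq).
Qed.

End Periods.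

(** The covering is any pointed model [p] with the prescribed subgroup, and the equality of
    M_{Re(omega)} with M is rendered as [p] being a homeomorphism. *)
Theorem corollary18 (R : realType) (M : topologicalType)
    (A : set (chart R M)) (omega : one_form R M 'rV[R[i]]_3)
    (p0 : M) (N : topologicalType) (p : N -> M) (y0 : N)
    (hM : riemann_surface A) (hMc : connected [set: M])
    (homega : weierstrass_representation A omega)
    (hclosed : closed_form A (re_form omega))
    (hp : covering_of_form A (re_form omega) p0 p y0) :
  [/\ exists2 phi : N -> 'rV[R]_3,
        conformal_immersion (pullback_atlas p A) phi &
        is_pullback A (pullback_atlas p A) p omega (weierstrass_of phi),
      (forall phi psi : N -> 'rV[R]_3,
        conformal_immersion (pullback_atlas p A) phi ->
        is_pullback A (pullback_atlas p A) p omega (weierstrass_of phi) ->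
        conformal_immersion (pullback_atlas p A) psi ->
        is_pullback A (pullback_atlas p A) p omega (weierstrass_of psi) ->
        exists b : 'rV[R]_3, forall y, psi y = phi y + b),
      ((exists2 phi : M -> 'rV[R]_3, conformal_immersion A phi &
          form_eq A (weierstrass_of phi) omega) <->
        (forall I, is_period A omega I -> purely_imaginary I)) &
      (is_homeomorphism p <->
        (forall I, is_period A omega I -> purely_imaginary I))].
Proof.
have [_ hA] := hM.
have [hcov cN py0 _] := hp; have [pc _] := hcov; rewrite -py0 in hp.
have ha := real_form_re homega.
have hs : smooth_form A (re_form omega) by case: homega => _ [].
have [phi lphi] := primitive_on_covering hA ha hs hclosed hp.
have homeo : (forall I, is_period A omega I -> purely_imaginary I) ->
    is_homeomorphism p.
  move=> im; apply: (covering_homeomorphism hA hp hMc) => gamma s.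
  exact: imaginary_periods.
(* A lift of [p] composed with the inverse of [p] is a lift of the identity, that is, a global
   primitive on [M]. *)
have descend : is_homeomorphism p -> exists psi : M -> 'rV[R]_3,
    lifts (is_primitive A (re_form omega)) id setT psi.
  move=> [_ [s [sc _ ps]]]; exists (phi \o s).
  have sc' : {within setT, continuous s} by exact: continuous_subspaceT.
  apply: (eq_lifts (h1 := p \o s)) (lifts_comp sc' _ lphi) => //.
  by move=> x _ /=; rewrite ps.
split.
- exists phi; first exact: (lift_conformal_immersion hA homega lphi).
  exact: (lift_is_pullback hA homega lphi).
- move=> f g cf pf cg pg.
  exact: (pullback_immersion_unique hA pc hcov cN (inhabits y0) cf pf cg pg).
- split=> [[psi cpsi wpsi]|/homeo/descend[psi lpsi]].
    exact: (primitive_periods hA homega (immersion_primitive cpsi wpsi)).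
  have [cpsi wpsi] := primitive_immersion hA homega lpsi.
  by exists psi.
- split=> [/descend[psi lpsi]|]; last exact: homeo.
  exact: (primitive_periods hA homega (lift_id_primitive hA lpsi)).
Qed.
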